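(* There exist $\theta_1>0$ and $M_1<\infty$ such that for every integer $n\ge 2$, every integer $k$ with $\frac13 n\le k\le \frac23 n$, and every probable value $s$ of $S_n$, there exists a coupling of $W:=S_k[n,s]-\frac{sk}{n}$ with $Z\sim N(0,1)$ such that $$\mathbf{E}\left[e^{\theta|W-\sigma_{n,k}Z|}\right]\le \exp\left\{1+M_1\theta^2\frac{s^2}{n}\right\}\qquad\text{for all }\theta\le\theta_1.$$
   Context: $S_n=X_1+\ldots+X_n$ where $X_1,X_2,\ldots$ are i.i.d. with $X_i=\pm1$ with probability $1/2$ each. An integer $s$ is a probable value of $S_n$ if $\mathbf{P}\{S_n=s\}>0$, equivalently $|s|\le n$ and $n-s$ is even. For $0\le k\le n$ and a probable value $s$ of $S_n$, $S_k[n,s]$ denotes a random variable whose distribution is the conditional distribution of $S_k$ given $S_n=s$ (equivalently, the sum of the first $k$ coupons drawn uniformly without replacement from a box of $n$ coupons, of which $(n+s)/2$ are labeled $+1$ and $(n-s)/2$ are labeled $-1$). Set $\sigma_{n,k}^2=\frac{1}{n}k(n-k)$, $\sigma_{n,k}\ge 0$. A coupling of random variables $X,Y$ satisfying certain statements means a probability space carrying random variables with the same marginal distributions as $X$ and $Y$ respectively and satisfying the stated mutual relationships. *)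

(* Defs.v *)
From HB Require Import structures.
From mathcomp Require Import all_boot all_order all_algebra.
From mathcomp Require Import all_classical all_reals all_analysis.

Set Implicit Arguments.
Unset Strict Implicit.
Unset Printing Implicit Defensive.

Import Order.TTheory GRing.Theory Num.Theory.

Local Open Scope classical_set_scope.
Local Open Scope ring_scope.

Section random_walk.
Context {R : realType} {d : measure_display} {T : measurableType d}.
Variable P : probability T R.

Definition mutually_independent (X : nat -> {RV P >-> R}) : Prop :=
  forall (J : seq nat) (B : nat -> set R), uniq J ->
    (forall i, measurable (B i)) ->
    P (\bigcap_(i in [set` J]) (X i @^-1` B i)) =
    (\prod_(i <- J) P (X i @^-1` B i))%E.

Definition fair_sign (X : {RV P >-> R}) : Prop :=
  P (X @^-1` [set 1]) = (2^-1)%:E /\ P (X @^-1` [set -1]) = (2^-1)%:E.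

Definition iid_fair_signs (X : nat -> {RV P >-> R}) : Prop :=
  mutually_independent X /\ forall i, fair_sign (X i).

(* The steps are numbered from 0: X 0, X 1, ... stand for X_1, X_2, ... *)
Definition walk (X : nat -> {RV P >-> R}) (n : nat) (w : T) : R :=
  \sum_(i < n) X i w.

Definition walk_event (X : nat -> {RV P >-> R}) (n : nat) (s : int) : set T :=
  [set w | walk X n w = s%:~R].

Definition probable_value (X : nat -> {RV P >-> R}) (n : nat) (s : int) : Prop :=
  (0 < P (walk_event X n s))%E.

(* Elementary conditioning; meaningful only when P B > 0. *)
Definition cond_distribution (Y : T -> R) (B : set T) (A : set R) : \bar R :=
  (fine (P (Y @^-1` A `&` B)) / fine (P B))%:E.

(* The distribution of S_k[n,s]. *)
Definition bridge_distribution (X : nat -> {RV P >-> R}) (n k : nat) (s : int)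
    : set R -> \bar R :=
  cond_distribution (walk X k) (walk_event X n s).

End random_walk.

Definition has_distribution {R : realType} {d : measure_display}
    {T : measurableType d} (P : probability T R) (X : {RV P >-> R})
    (mu : set R -> \bar R) : Prop :=
  forall A : set R, measurable A -> distribution P X A = mu A.

Definition bridge_sigma {R : realType} (n k : nat) : R :=
  Num.sqrt (n%:R^-1 * (k%:R * (n%:R - k%:R))).

(* Main.v *)
Require Import Defs.
From HB Require Import structures.
From mathcomp Require Import all_boot all_order all_algebra.
From mathcomp Require Import all_classical all_reals all_analysis.
From mathcomp Require Import measurable_realfun zify ring lra.

(** Write [s = 2 m - n]. Given [S_n = s], the number [j] of plus signs among the
    first [k] steps is hypergeometric, with weight ['C(k, j) 'C(n - k, m - j)],
    and [W = 2 x] where [x := j - k m / n]. Put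
    [v := k (n - k) m (n - m) / n ^ 3], so that [4 v = sigma ^ 2 (1 - s ^ 2 / n ^ 2)].
    The coupling takes [Z] as the sample point and [j] as a function of [Z].

    For [|s| <= n / 3] and [n] large, the ratio of consecutive weights is at most
    [exp (- x / v + O(x ^ 2 / n ^ 2))]. Let [M t := t / (1 + 100 t / n)]; the density
    of [M^-1 (sqrt v Z)], shifted by a constant, has larger consecutive ratios, so
    it dominates [x] in the likelihood ratio order. The Moebius map [M] takes
    [[- n / 200, +oo[] onto [[- n / 100, n / 100[], hence the comparison is exact
    after conditioning [sqrt v Z] on the window []- n / 100, n / 100]], and no tail
    estimate is needed. The symmetry [m -> n - m] gives the reverse bound, so the
    conditional quantile coupling satisfies [|x - sqrt v Z| <= C (1 + Z ^ 2)];
    outside the window this is trivial because [Z ^ 2] is at least of order [n].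
    Replacing [2 sqrt v] by [sigma] costs [|s| |Z| / sqrt n], which is absorbed by
    [theta |s| |Z| / sqrt n <= theta ^ 2 s ^ 2 / n + Z ^ 2 / 4].

    For [|s| > n / 3] any coupling works, [W] being subgaussian with variance
    proxy of order [n <= 9 s ^ 2 / n]. *)

Set Implicit Arguments.
Unset Strict Implicit.
Unset Printing Implicit Defensive.

Import Order.TTheory GRing.Theory Num.Theory.
Import numFieldNormedType.Exports.

(** * Hypergeometric weights as counts of subsets *)

(** The guard matters: for [j > m] the truncated [m - j] is [0], and the product would be
    ['C(k, j)]. *)
Definition hyp_weight (n k m j : nat) : nat :=
  if (j <= m)%N then ('C(k, j) * 'C(n - k, m - j))%N else 0%N.

Section counting.
Variables (n k : nat).
Hypothesis kn : (k <= n)%N.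

Definition prefix_set : {set 'I_n} := [set i : 'I_n | (i < k)%N]%SET.

Lemma card_prefix_set : #|prefix_set| = k.
Proof.
have E : prefix_set = (widen_ord kn @: [set: 'I_k])%SET.
  apply/finset.setP => i; rewrite inE; apply/idP/imsetP => [ik|[j _ ->]]/=; last exact: ltn_ord.
  by exists (Ordinal ik); rewrite ?inE//; exact: val_inj.
rewrite E card_imset ?cardsT ?card_ord// => i j /(congr1 val) /= ij.
exact: val_inj.
Qed.

(** [B] is the set of times of plus steps. It corresponds bijectively to the pair of its traces on
    the prefix and on the complement, which are chosen freely with sizes [j] and [m - j]. *)
Lemma card_hyp_weight m j :
  #|[pred B : {set 'I_n} | (#|B| == m) && (#|B :&: prefix_set| == j)]| =
  hyp_weight n k m j.
Proof.
rewrite /hyp_weight; case: leqP => [jm|mj]; last first.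
  apply: eq_card0 => B; rewrite !inE; apply/negP => /andP[/eqP Bm /eqP Bj].
  by move: mj; rewrite -Bm -Bj ltnNge subset_leq_card// finset.subsetIl.
set K := prefix_set.
pose U := [set A : {set 'I_n} | A \subset K & #|A| == j]%SET.
pose V := [set A : {set 'I_n} | A \subset ~: K & #|A| == (m - j)%N]%SET.
have cU : #|U| = 'C(k, j) by rewrite cards_draws card_prefix_set.
have cV : #|V| = 'C(n - k, m - j).
  by rewrite cards_draws cardsCs finset.setCK card_prefix_set card_ord.
rewrite -cU -cV -cardsX.
rewrite -(@card_in_imset _ _ (fun AB : {set 'I_n} * {set 'I_n} => AB.1 :|: AB.2)%SET).
  apply: eq_card => B; rewrite !inE; apply/idP/imsetP.
    move=> /andP[/eqP Bm /eqP Bj]; exists ((B :&: K)%SET, (B :\: K)%SET).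
      rewrite !inE/= finset.subsetIr Bj eqxx finset.setDE finset.subsetIr/=.
      by have := cardsID K B; rewrite Bm -finset.setDE Bj => <-; rewrite addKn.
    by rewrite /= finset.setID.
  move=> [[A C]]; rewrite !inE/= => /andP[/andP[AK /eqP Aj] /andP[CK /eqP Cm]] ->.
  have AC : (A :&: C = finset.set0)%SET.
    apply/eqP; rewrite finset.setIC finset.setI_eq0 finset.disjoints_subset.
    by rewrite (fintype.subset_trans CK)// finset.setCS.
  rewrite cardsU AC cards0 subn0 Aj Cm subnKC// eqxx/=.
  rewrite finset.setIUl (finset.setIidPl AK) (_ : (C :&: K = finset.set0)%SET) ?finset.setU0 ?Aj//.
  by apply/eqP; rewrite finset.setI_eq0 finset.disjoints_subset.
move=> [A C] [A' C']; rewrite !inE/= => /andP[/andP[AK _] /andP[CK _]].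
move=> /andP[/andP[AK' _] /andP[CK' _]] E.
have r (X Y : {set 'I_n}) : X \subset K -> Y \subset (~: K)%SET ->
   ((X :|: Y) :&: K = X)%SET /\ ((X :|: Y) :\: K = Y)%SET.
  move=> XK YK; rewrite finset.setIUl (finset.setIidPl XK) finset.setDUl.
  rewrite (_ : (Y :&: K = finset.set0)%SET); last first.
    by apply/eqP; rewrite finset.setI_eq0 finset.disjoints_subset.
  rewrite (_ : (X :\: K = finset.set0)%SET); last by apply/eqP; rewrite finset.setD_eq0.
  by rewrite finset.setU0 finset.set0U finset.setDE (finset.setIidPl YK).
have [a b] := r _ _ AK CK; have [a' b'] := r _ _ AK' CK'.
by congr pair; [rewrite -a -a' E|rewrite -b -b' E].
Qed.

End counting.

Local Open Scope classical_set_scope.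
Local Open Scope ring_scope.

(** * The standard normal law: distribution function and a quadratic exponential moment *)

Section gaussian.
Context {R : realType}.
Local Notation N := (normal_prob (0 : R) 1).
Local Notation mu := (@lebesgue_measure R).
Local Notation phi := (normal_pdf (0 : R) 1).

Definition Phi (x : R) : R := fine (N `]-oo, x]).

(** The Radon-Nikodym derivative of [N] and [phi] have the same integral over every measurable set,
    hence agree almost everywhere. *)
Lemma ge0_integral_normal_prob (f : measurableTypeR R -> \bar R) :
  measurable_fun setT f -> (forall x, 0 <= f x)%E ->
  (\int[N]_x f x = \int[mu]_x (f x * (phi x)%:E))%E.
Proof.
move=> mf f0.
have dom := @normal_prob_dominates R 0 1.
rewrite -(Radon_Nikodym_SigmaFinite.change_of_variables dom)//=.
apply: ae_eq_integral => //.
- apply: emeasurable_funM => //; apply: (measurable_int mu).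
  exact: Radon_Nikodym_SigmaFinite.f_integrable.
- apply: emeasurable_funM => //=; apply/measurableT_comp => //=.
  exact: measurable_normal_pdf.
- apply: ae_eqe_mul2l => /=.
  apply: integral_ae_eq => //=.
  + exact: Radon_Nikodym_SigmaFinite.f_integrable.
  + by apply/measurableT_comp =>//; exact: measurable_normal_pdf.
  + by move=> E _ mE; rewrite -Radon_Nikodym_SigmaFinite.f_integral.
Qed.

Lemma normal_prob_fin_num A : measurable A -> N A \is a fin_num.
Proof. by move=> mA; exact: fin_num_measure. Qed.

Lemma normal_pdf_gt0 x : 0 < phi x.
Proof.
by rewrite normal_pdfE ?oner_neq0// mulr_gt0 ?expR_gt0// normal_peak_gt0 ?oner_neq0.
Qed.

Lemma PhiE : Phi = (fun x => \int[mu]_(t in [set` `]-oo, x]]) (phi t))%R.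
Proof. by []. Qed.

Lemma is_derive_Phi (x : R) : is_derive x (1 : R) Phi (phi x).
Proof.
have xx : x < x + 1 by rewrite ltrDl.
have [] := @continuous_FTC1 R phi -oo%O x (x + 1) xx.
- apply: (@integrableS _ _ _ mu setT) => //.
  exact: integrable_normal_pdf.
- by rewrite ltNyr.
- by apply: continuous_normal_pdf; rewrite oner_neq0.
rewrite -PhiE derive1E => dP <-.
exact: derivableP.
Qed.

Lemma continuous_Phi : continuous Phi.
Proof.
move=> x; apply/differentiable_continuous/derivable1_diffP.
exact: (@ex_derive _ _ _ _ _ _ _ (is_derive_Phi x)).
Qed.

Lemma Phi_lt : {homo Phi : x y / x < y}.
Proof.
move=> x y xy; apply: (@gtr0_derive1_lt_cc _ Phi x y) => //.
- by move=> z _; exact: (@ex_derive _ _ _ _ _ _ _ (is_derive_Phi z)).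
- move=> z _; rewrite derive1E (@derive_val _ _ _ _ _ _ _ (is_derive_Phi z)).
  exact: normal_pdf_gt0.
- by apply: continuous_subspaceT; exact: continuous_Phi.
- by rewrite in_itv/= lexx ltW.
- by rewrite in_itv/= lexx ltW.
Qed.

Lemma Phi_ltE x y : (Phi x < Phi y) = (x < y).
Proof. exact: (leW_mono (le_mono Phi_lt)). Qed.

Lemma Phi_leE x y : (Phi x <= Phi y) = (x <= y).
Proof. exact: (le_mono Phi_lt). Qed.

Lemma normal_probNyE x : N `]-oo, x] = (Phi x)%:E.
Proof. by rewrite /Phi fineK// normal_prob_fin_num. Qed.

Lemma normal_pdf_opp x : phi (- x) = phi x.
Proof.
by rewrite !normal_pdfE ?oner_neq0// /normal_fun !subr0 sqrrN.
Qed.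

(** [Phi x + Phi (- x)] has derivative [phi x - phi (- x) = 0], so it is constant. *)
Lemma Phi_symmetry x y : Phi x - Phi y = Phi (- y) - Phi (- x).
Proof.
have H : forall z, is_derive z (1 : R) (Phi + (Phi \o -%R)) 0.
  move=> z; have dP := is_derive_Phi z.
  have dQ := is_derive_Phi (- z).
  apply: is_derive_eq => /=.
  by rewrite normal_pdf_opp; lra.
have := @is_derive_0_is_cst _ _ x y H; rewrite /= => E.
have {}E : Phi x + Phi (- x) = Phi y + Phi (- y) := E.
lra.
Qed.

Lemma normal_prob_itv_oc x y : x <= y -> N `]x, y] = (Phi y - Phi x)%:E.
Proof.
move=> xy.
have : N `]-oo, y] = (N `]-oo, x] + N `]x, y])%E.
  rewrite -measureU//; first by rewrite -itv_bndbnd_setU.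
  apply/seteqP; split => z //=; rewrite !in_itv/= => -[zx /andP[xz _]].
  by move: (lt_le_trans xz zx); rewrite ltxx.
rewrite !normal_probNyE => E.
have f : N `]x, y] \is a fin_num by exact: normal_prob_fin_num.
move: E; rewrite -(fineK f) -EFinD => -[->]; congr EFin; lra.
Qed.

(** Since [3 / 8 - 1 / 2 = - 1 / 8], the integrand times [phi] is twice the centred normal density
    of standard deviation [2]. *)
Lemma expectation_exp_sqr_normal :
  (\int[N]_z (expR (3 / 8 * z ^+ 2))%:E = 2%:E)%E.
Proof.
rewrite ge0_integral_normal_prob//.
- transitivity (\int[mu]_z (2%:E * (normal_pdf 0 2 z)%:E))%E.
    apply: eq_integral => z _; rewrite -!EFinM; congr EFin.
    rewrite !normal_pdfE ?oner_neq0// /normal_fun /normal_peak mulrCA -expRD.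
    rewrite [RHS]mulrA; congr (_ * _).
    + rewrite expr1n mul1r -mulrnAr (sqrtrM _ (sqr_ge0 _)) sqrtr_sqr ger0_norm//.
      by rewrite invfM mulrA divff// mul1r.
    + by congr expR; rewrite !subr0 expr1n; field.
  rewrite integralZl//; last exact: integrable_normal_pdf.
  by rewrite integral_normal_pdf mule1.
- apply/measurableT_comp => //; apply/measurableT_comp => //.
  by apply: measurable_funM => //; exact: measurable_funX.
Qed.

End gaussian.

(** * Bounds for the ratio of consecutive weights *)

Section ratio.
Context {R : realType}.
Implicit Types x z v n : R.

Lemma expR_le_1Dx z : - 4^-1 <= z -> expR (z - z ^+ 2) <= 1 + z.
Proof.
move=> hz.
have h1 : 0 < 1 + z by lra.
rewrite -[expR _]invrK -expRN invf_ple ?posrE ?expR_gt0//.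
have [z0|z0] := leP 0 z.
  apply: (@le_trans _ _ (1 + (- (z - z ^+ 2)))); last exact: expR_ge1Dx.
  rewrite -[_^-1]mul1r ler_pdivrMr//; have : 0 <= z ^+ 3 by rewrite exprn_ge0.
  nra.
(* For [z < 0] the bound [1 + u <= expR u] at [u = z ^ 2 - z] gives only [1 + z ^ 3 < 1] after
   multiplication by [1 + z]; using it at [u / 2] and squaring is sharp enough. *)
have -> : expR (- (z - z ^+ 2)) = (expR ((z ^+ 2 - z) / 2)) ^+ 2.
  by rewrite -expRM_natl; congr expR; lra.
have w0 : 0 <= (z ^+ 2 - z) / 2 by nra.
apply: (@le_trans _ _ ((1 + (z ^+ 2 - z) / 2) ^+ 2)); last first.
  by rewrite lerXn2r// ?nnegrE ?expR_ge1Dx ?expR_ge0//; lra.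
rewrite -[_^-1]mul1r ler_pdivrMr//.
have E : (1 + (z ^+ 2 - z) / 2) ^+ 2 * (1 + z) - 1 =
   z ^+ 2 * ((1 + z) * (1 - z) ^+ 2 / 4 + z) by field.
rewrite -subr_ge0 E; apply: mulr_ge0; first exact: sqr_ge0.
have z2 : z ^+ 2 <= 16^-1 by nra.
have z3 : 0 <= z ^+ 2 * (z + 4^-1) by rewrite mulr_ge0 ?sqr_ge0//; lra.
have -> : (1 + z) * (1 - z) ^+ 2 / 4 + z = (1 + 3 * z - z ^+ 2 + z ^+ 3) / 4 by field.
have -> : z ^+ 3 = z ^+ 2 * (z + 4^-1) - z ^+ 2 / 4 by field.
lra.
Qed.

Lemma le_1Bx_expR x : 1 - x <= expR (- x).
Proof. exact: expR_ge1Dx. Qed.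

(** Here [P - x <= P exp (- x / P)] and [P + x + 1 >= P exp (x / P - 81 x ^ 2 / n ^ 2)]. The
    prefactors cancel by [P1 * P2 = P3 * P4], and the linear terms add up to [- x / v]. The lower
    limit on [x] ensures [x / P >= - 1 / 4]. *)
Lemma ratio_le_local (P1 P2 P3 P4 n v x : R) : 0 < n ->
  P1 * P2 = P3 * P4 -> n / 9 <= P1 -> n / 9 <= P2 -> n / 9 <= P3 -> n / 9 <= P4 ->
  v^-1 = P1^-1 + P2^-1 + P3^-1 + P4^-1 -> - (n / 36) <= x ->
  0 <= P1 - x -> 0 <= P2 - x ->
  (P1 - x) * (P2 - x) <=
  expR (- x / v + 162 * x ^+ 2 / n ^+ 2) * ((P3 + x + 1) * (P4 + x + 1)).
Proof.
move=> n0 PP h1 h2 h3 h4 hv hx hx1 hx2.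
have n9 : 0 < n / 9 by lra.
have p1 : 0 < P1 by lra. have p2 : 0 < P2 by lra.
have p3 : 0 < P3 by lra. have p4 : 0 < P4 by lra.
have ub P : 0 < P -> P - x <= P * expR (- (x / P)).
  move=> p; rewrite -[leLHS](@mulfVK _ P) ?gt_eqF// [leLHS]mulrC ler_pM2l//.
  by apply: le_trans (le_1Bx_expR _); rewrite mulrBl divff ?gt_eqF.
have lb P : n / 9 <= P -> P * expR (x / P - 81 * x ^+ 2 / n ^+ 2) <= P + x + 1.
  move=> h; have p : 0 < P by lra.
  apply: (@le_trans _ _ (P * (1 + x / P))); last first.
    by rewrite mulrDr mulr1 mulrC mulfVK ?gt_eqF//; lra.
  rewrite ler_pM2l//.
  have hz : - 4^-1 <= x / P.
    by rewrite ler_pdivlMr//; lra.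
  apply: le_trans (expR_le_1Dx hz); rewrite ler_expR lerD2l lerN2.
  have -> : 81 * x ^+ 2 / n ^+ 2 = x ^+ 2 * ((n / 9)^-1) ^+ 2.
    by field; rewrite gt_eqF.
  rewrite exprMn; apply: ler_wpM2l; first exact: sqr_ge0.
  by apply: lerXn2r; rewrite ?nnegrE ?lef_pV2 ?posrE ?invr_ge0//; lra.
apply: (@le_trans _ _ ((P1 * expR (- (x / P1))) * (P2 * expR (- (x / P2))))).
  by apply: ler_pM => //; exact: ub.
apply: (@le_trans _ _ (expR (- x / v + 162 * x ^+ 2 / n ^+ 2) *
  ((P3 * expR (x / P3 - 81 * x ^+ 2 / n ^+ 2)) *
   (P4 * expR (x / P4 - 81 * x ^+ 2 / n ^+ 2))))); last first.
  apply: ler_wpM2l; first exact: expR_ge0.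
  apply: ler_pM; [| | exact: lb | exact: lb].
  - by rewrite mulr_ge0// ?expR_ge0// ltW.
  - by rewrite mulr_ge0// ?expR_ge0// ltW.
rewrite mulrACA (mulrACA P3) PP -!expRD mulrCA -expRD.
rewrite ler_pM2l ?mulr_gt0// ler_expR hv.
lra.
Qed.

(** Serves for large [x], where the quadratic error of the local bound may be too big: only the
    decay of the numerator is used, the denominator being at least [P3 * P4]. *)
Lemma ratio_le_global (P1 P2 P3 P4 n x : R) : 0 < n ->
  P1 * P2 = P3 * P4 -> 0 < P1 <= n -> 0 < P2 <= n -> 0 < P3 -> 0 < P4 ->
  0 <= x -> 0 <= P1 - x -> 0 <= P2 - x ->
  (P1 - x) * (P2 - x) <=
  expR (- (2 * x / n)) * ((P3 + x + 1) * (P4 + x + 1)).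
Proof.
move=> n0 PP /andP[p1 h1] /andP[p2 h2] p3 p4 x0 hx1 hx2.
have ub P : 0 < P -> P <= n -> P - x <= P * expR (- (x / n)).
  move=> p pn; rewrite -[leLHS](@mulfVK _ P) ?gt_eqF// [leLHS]mulrC ler_pM2l//.
  apply: le_trans (le_1Bx_expR _); rewrite mulrBl divff ?gt_eqF// lerD2l lerN2.
  by apply: ler_wpM2l => //; rewrite lef_pV2 ?posrE.
apply: (@le_trans _ _ ((P1 * expR (- (x / n))) * (P2 * expR (- (x / n))))).
  by apply: ler_pM => //; exact: ub.
rewrite mulrACA PP -expRD [leLHS]mulrC.
have -> : - (2 * x / n) = - (x / n) - x / n by lra.
apply: ler_wpM2l; first exact: expR_ge0.
by apply: ler_pM; lra.
Qed.

End ratio.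

(** * The Moebius change of variable and the comparison density *)

Section moebius.
Context {R : realType}.
Implicit Types (a v t x n : R).

Definition moebius a t : R := t / (1 + a * t).

Lemma moebius_step a t : 0 < a -> - 2^-1 <= a * t ->
  moebius a (t + 1) - moebius a t = ((1 + a * t) * (1 + a * (t + 1)))^-1.
Proof.
move=> a0 h; rewrite /moebius; field.
by rewrite !gt_eqF//; nra.
Qed.

Lemma moebius_le a s t : 0 <= a -> - 2^-1 <= a * s -> s <= t ->
  moebius a s <= moebius a t.
Proof.
move=> a0 h st; have h' : - 2^-1 <= a * t by nra.
rewrite /moebius ler_pdivrMr; last lra.
by rewrite mulrAC ler_pdivlMr; [nra|lra].
Qed.

(** Up to a constant, the density of the preimage under [moebius a] of a centred normal variable of
    variance [v]; [(1 + a * t) ^- 2] is the derivative of [moebius a]. *)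
Definition moebius_density a v t : R :=
  expR (- (moebius a t) ^+ 2 / (2 * v)) / (1 + a * t) ^+ 2.

(** In the constant [27], the part [25] pays for the change of the Jacobian factor and the part [2]
    for replacing the increment of half the squared Moebius map by the drift [(t + 1) / E ^ 3]. *)
Lemma moebius_density_step a v t : 0 < a -> 0 < v -> 16 * (a * v) <= 100 ->
  - 2^-1 <= a * t ->
  moebius_density a v t *
    expR (- (((t + 1) / (1 + a * (t + 1)) ^+ 3 + 27) / v)) <=
  moebius_density a v (t + 1).
Proof.
move=> a0 v0 av h.
rewrite /moebius_density; set D := 1 + a * t; set E := 1 + a * (t + 1).
have D2 : 2^-1 <= D by rewrite /D; lra.
have ED : E = D + a by rewrite /E /D; ring.
have D0 : 0 < D by lra. have E0 : 0 < E by lra.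
rewrite ler_pdivlMr ?exprn_gt0//.
(* [D >= 1 / 2] gives [E / D <= 1 + 2 a <= exp (2 a)], and [4 a <= 25 / v] by the bound on
   [a * v]. *)
have hED : E ^+ 2 / D ^+ 2 <= expR (25 / v).
  rewrite -expr_div_n.
  apply: (@le_trans _ _ (expR (2 * a) ^+ 2)).
    apply: lerXn2r; rewrite ?nnegrE ?expR_ge0//.
      by apply: divr_ge0; lra.
    apply: le_trans (expR_ge1Dx _).
    rewrite ler_pdivrMr// ED; nra.
  rewrite -expRM_natl ler_expR ler_pdivlMr; last lra.
  lra.
set X := expR _; set Y := expR _; set Z := expR _.
have -> : X / D ^+ 2 * Y * E ^+ 2 = X * Y * (E ^+ 2 / D ^+ 2) by ring.
apply: (@le_trans _ _ (X * Y * expR (25 / v))).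
  by apply: ler_wpM2l => //; rewrite mulr_ge0 ?expR_ge0.
rewrite /X /Y /Z -!expRD ler_expR.
set M := moebius a t; set M' := moebius a (t + 1).
have hM : M' ^+ 2 - M ^+ 2 <= 2 * ((t + 1) / E ^+ 3) + 4.
  have -> : M' ^+ 2 - M ^+ 2 = (M' - M) * (M' + M) by ring.
  have dM : M' - M = (D * E)^-1 by exact: moebius_step.
  have MM : M <= M' by rewrite -subr_ge0 dM invr_ge0 mulr_ge0 ?ltW.
  rewrite dM.
  apply: (@le_trans _ _ ((D * E)^-1 * (2 * M'))).
    by apply: ler_wpM2l; [rewrite invr_ge0 mulr_ge0 ?ltW|lra].
  have -> : (D * E)^-1 * (2 * M') = 2 * ((t + 1) / (D * E ^+ 2)).
    by rewrite /M' /moebius -/E; field; rewrite !gt_eqF.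
  suff : (t + 1) / (D * E ^+ 2) <= (t + 1) / E ^+ 3 + 2 by lra.
  (* Turning the factor [D] into [E] costs [(E - 1) / (D E ^ 3)], at most [2] because
     [D >= 1 / 2]. *)
  have -> : (t + 1) / (D * E ^+ 2) =
      (t + 1) / E ^+ 3 + (a * (t + 1)) / (D * E ^+ 3).
    by rewrite ED; field; rewrite -ED !gt_eqF.
  rewrite lerD2l ler_pdivrMr ?mulr_gt0 ?exprn_gt0//.
  have aE : a * (t + 1) = E - 1 by rewrite /E; ring.
  rewrite aE; have [E1|E1] := leP E 1.
    apply: (@le_trans _ _ 0); first lra.
    by rewrite !mulr_ge0 ?exprn_ge0 ?ltW.
  have : E <= E ^+ 3 by rewrite exprSr ler_peMl ?exprn_ege1 ?ltW.
  have E3 : 0 < E ^+ 3 by rewrite exprn_gt0.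
  nra.
have -> : - M ^+ 2 / (2 * v) - ((t + 1) / E ^+ 3 + 27) / v + 25 / v =
  (- M ^+ 2 / 2 - (t + 1) / E ^+ 3 - 27 + 25) / v.
  by field; rewrite !gt_eqF.
have -> : - M' ^+ 2 / (2 * v) = (- M' ^+ 2 / 2) / v by field; rewrite gt_eqF.
rewrite ler_pM2r ?invr_gt0//.
lra.
Qed.

(* The additive shift [28 <= x - t <= 29] pays for the lattice spacing and the
   curvature terms of order [1 / n]; the Moebius factor pays for skewness. *)
Lemma drift_local n t x : 100 * 200 <= n -> 28 <= x - t <= 29 ->
  - 2^-1 <= 100 / n * t <= 3 ->
  t / (1 + 100 / n * t) ^+ 3 + 27 <= x - 81 / 8 * x ^+ 2 / n.
Proof.
move=> n0 /andP[k1 k2]; set z := 100 / n * t => /andP[z1 z2].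
have n1 : 0 < n by lra.
have E3 : 0 < (1 + z) ^+ 3 by rewrite exprn_gt0//; lra.
have h1 : t / (1 + z) ^+ 3 <= t - 25 * t ^+ 2 / n.
  rewrite ler_pdivrMr//.
  have -> : 25 * t ^+ 2 / n = t * z / 4 by rewrite /z; field; rewrite gt_eqF.
  have : 0 <= t * z * (4 * (3 + 3 * z + z ^+ 2) - (1 + z) ^+ 3).
    apply: mulr_ge0.
      rewrite /z mulrCA; apply: mulr_ge0; first by rewrite divr_ge0//; lra.
      by rewrite -expr2 sqr_ge0.
    have : 0 <= (z + 1) * (3 - z) * (z + 4) by rewrite !mulr_ge0//; lra.
    nra.
  nra.
have h2 : 81 / 8 * x ^+ 2 / n <= (81 / 4 * t ^+ 2) / n + 1.
  have -> : 81 / 4 * t ^+ 2 / n + 1 = (81 / 4 * t ^+ 2 + n) / n.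
    by field; rewrite gt_eqF.
  rewrite ler_pM2r ?invr_gt0//.
  have : x ^+ 2 <= 2 * t ^+ 2 + 2 * (x - t) ^+ 2.
    by rewrite -subr_ge0 [leRHS](_ : _ = (x - t - t) ^+ 2); [exact: sqr_ge0|ring].
  have : (x - t) ^+ 2 <= 29 ^+ 2 by rewrite lerXn2r// ?nnegrE; lra.
  nra.
have h3 : 0 <= t ^+ 2 / n by rewrite divr_ge0 ?sqr_ge0// ltW.
lra.
Qed.

(** The cube is at least [64] and [t > 600], so [t / 64 + 27] stays below [8 x / 81], which is at
    most [2 x v / n]. *)
Lemma drift_global n v t x : 100 * 200 <= n -> 4 * n / 81 <= v -> t + 28 <= x ->
  3 < 100 / n * t ->
  (t / (1 + 100 / n * t) ^+ 3 + 27) / v <= 2 * x / n.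
Proof.
move=> n0 hv tx; set z := 100 / n * t => z1.
have n1 : 0 < n by lra.
have v0 : 0 < v by lra.
have t0 : 600 < t.
  have : n * 3 < 100 * t by rewrite mulrC -ltr_pdivlMr// mulrAC.
  lra.
have E3 : 64 <= (1 + z) ^+ 3 by nra.
rewrite ler_pdivrMr//.
apply: (@le_trans _ _ (t / 64 + 27)).
  rewrite lerD2r; apply: ler_wpM2l; first lra.
  by rewrite lef_pV2 ?posrE//; lra.
apply: (@le_trans _ _ (2 * x / n * (4 * n / 81))); last first.
  by apply: ler_wpM2l => //; rewrite divr_ge0//; lra.
have -> : 2 * x / n * (4 * n / 81) = 8 / 81 * x by field; rewrite gt_eqF.
lra.
Qed.

(** Compares one lattice step of the weights at [x] with one unit step of the density at [t]. Since
    [t] ranges over a unit interval, the inequality can be integrated over a lattice cell. *)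
Lemma ratio_moebius_density (P1 P2 P3 P4 n v x t : R) : 100 * 200 <= n ->
  P1 * P2 = P3 * P4 -> n / 9 <= P1 <= n -> n / 9 <= P2 <= n ->
  n / 9 <= P3 <= n -> n / 9 <= P4 <= n ->
  v^-1 = P1^-1 + P2^-1 + P3^-1 + P4^-1 -> 4 * n / 81 <= v <= n / 16 ->
  x - 30 <= t <= x - 29 -> - (n / 200) <= t -> 0 <= P1 - x -> 0 <= P2 - x ->
  (P1 - x) * (P2 - x) * moebius_density (100 / n) v t <=
  (P3 + x + 1) * (P4 + x + 1) * moebius_density (100 / n) v (t + 1).
Proof.
move=> N2 PP /andP[h1 g1] /andP[h2 g2] /andP[h3 g3] /andP[h4 g4] vinv.
move=> /andP[vl vu] /andP[t1 t2] tN x1 x2.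
have n0 : 0 < n by lra.
have v0 : 0 < v by lra.
set a := 100 / n.
have a0 : 0 < a by rewrite divr_gt0.
have aN : a * n = 100 by rewrite mulfVK ?gt_eqF.
clearbody a.
have at2 : - 2^-1 <= a * t.
  have : 0 <= a * (t + n / 200) by apply: mulr_ge0; lra.
  have -> : a * (t + n / 200) = a * t + a * n / 200 by ring.
  lra.
have d0 : 0 < (P3 + x + 1) * (P4 + x + 1) by apply: mulr_gt0; lra.
have av : 16 * (a * v) <= 100.
  by rewrite -aN mulrCA ler_pM2l//; lra.
have S := moebius_density_step a0 v0 av at2.
have D0 s : 0 <= moebius_density a v s.
  by rewrite divr_ge0 ?expR_ge0 ?sqr_ge0.
suff E : (P1 - x) * (P2 - x) <=
  expR (- (((t + 1) / (1 + a * (t + 1)) ^+ 3 + 27) / v)) *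
    ((P3 + x + 1) * (P4 + x + 1)).
  apply: (@le_trans _ _ ((expR (- (((t + 1) / (1 + a * (t + 1)) ^+ 3 + 27) / v)) *
    ((P3 + x + 1) * (P4 + x + 1))) * moebius_density a v t)).
    exact: ler_wpM2r.
  rewrite -mulrA mulrCA (mulrC (expR _)).
  by apply: ler_wpM2l => //; exact: ltW.
have aE : a = 100 / n by rewrite -aN mulfK ?gt_eqF.
(* Up to the threshold the local ratio bound applies; beyond it the cube has divided the drift by at
   least [64], so the global decay suffices. *)
have [z3|z3] := leP (a * (t + 1)) 3.
  apply: le_trans (ratio_le_local n0 PP h1 h2 h3 h4 vinv _ x1 x2) _; first lra.
  apply: ler_wpM2r; first exact: ltW.
  rewrite ler_expR.
  have h28 : 28 <= x - (t + 1) <= 29 by apply/andP; split; lra.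
  have hz : - 2^-1 <= a * (t + 1) <= 3 by rewrite z3 andbT mulrDr mulr1; lra.
  rewrite {}aE in hz *; have D := drift_local N2 h28 hz.
  (* By [v <= n / 16], the error [162 x ^ 2 / n ^ 2] is at most [81 / 8 x ^ 2 / (n v)]. *)
  apply: (@le_trans _ _ (- ((x - 81 / 8 * x ^+ 2 / n) / v))); last first.
    by rewrite lerN2 ler_pM2r ?invr_gt0.
  have -> : - ((x - 81 / 8 * x ^+ 2 / n) / v) =
     - x / v + x ^+ 2 * (81 / 8 / n / v) by ring.
  rewrite lerD2l mulrAC [leLHS]mulrC; apply: ler_wpM2l; first exact: sqr_ge0.
  rewrite ler_pdivlMr// ler_pdivlMr//.
  have -> : 162 / n ^+ 2 * v * n = 162 / n * v by field; rewrite gt_eqF.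
  by rewrite mulrAC ler_pdivrMr//; lra.
have t10 : 0 < t + 1.
  have : 0 < a * (t + 1) by lra.
  by rewrite pmulr_rgt0.
apply: le_trans (@ratio_le_global R P1 P2 P3 P4 n x n0 PP _ _ _ _ _ x1 x2) _; try lra.
apply: ler_wpM2r; first exact: ltW.
by rewrite ler_expR lerN2 aE; apply: drift_global; rewrite -?aE//; lra.
Qed.

End moebius.

(** * Likelihood ratio order and comparison of tails *)

Section likelihood_ratio.
Context {R : realType}.
Variables (K : nat) (p q : nat -> R) (c : pred nat).
Hypotheses (p0 : forall j, 0 <= p j) (q0 : forall j, 0 <= q j).
Hypothesis cS : forall j, c j -> c j.+1.
Hypothesis qc : forall j, (j < K)%N -> ~~ c j -> q j = 0.
Hypothesis step : forall j, (j < K)%N -> c j ->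
  exists2 r : R, 0 <= r & p j.+1 <= r * p j /\ r * q j <= q j.+1.

(** A common bound [r] separates the two ratios without division, so zero weights are allowed. Such
    bounds multiply along a chain, which stays in [c] because [c] is closed upwards. *)
Lemma likelihood_ratio_chain i d : (i + d <= K)%N -> c i ->
  exists2 r : R, 0 <= r & p (i + d)%N <= r * p i /\ r * q i <= q (i + d)%N.
Proof.
move=> + ci; elim: d => [_|d IH idK].
  by exists 1; rewrite ?addn0 ?mul1r.
have [|r r0 [hp hq]] := IH; first by rewrite ltnW// -addnS.
have cid : c (i + d)%N by elim: (d) => [|e he]; rewrite ?addn0// addnS cS.
have [|r' r'0 [hp' hq']] := @step (i + d)%N _ cid; first by rewrite -addnS.
exists (r' * r); first exact: mulr_ge0.
rewrite addnS -!mulrA; split.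
  by apply: le_trans hp' _; exact: ler_wpM2l.
by apply: le_trans hq'; exact: ler_wpM2l.
Qed.

Lemma likelihood_ratio_le i j : (i < j)%N -> (j <= K)%N -> p j * q i <= p i * q j.
Proof.
move=> ij jK; have [ci|ci] := boolP (c i); last first.
  by rewrite qc ?mulr0 ?mulr_ge0//; exact: leq_trans jK.
have [|r r0 [hp hq]] := @likelihood_ratio_chain i (j - i) _ ci.
  by rewrite subnKC// ltnW.
rewrite subnKC ?(ltnW ij)// in hp hq.
apply: (@le_trans _ _ (r * p i * q i)); first exact: ler_wpM2r.
by rewrite -mulrA mulrCA; exact: ler_wpM2l.
Qed.

(** Once the product of the two tails is cancelled, both sides are double sums over [i < J <= j],
    compared termwise. *)
Lemma likelihood_ratio_tail J : (J <= K.+1)%N ->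
  (\sum_(J <= j < K.+1) p j) * (\sum_(0 <= j < K.+1) q j) <=
  (\sum_(J <= j < K.+1) q j) * (\sum_(0 <= j < K.+1) p j).
Proof.
move=> JK; rewrite !(big_cat_nat (n := J) (m := 0) (p := K.+1))//= !mulrDr.
rewrite [X in _ + X <= _]mulrC lerD2r.
rewrite mulrC [leRHS]mulrC !mulr_suml !big_nat; apply: ler_sum => i /andP[_ iJ].
rewrite !mulr_sumr; apply: ler_sum => j /andP[Jj jK].
by rewrite mulrC; apply: likelihood_ratio_le => //; exact: leq_trans Jj.
Qed.

End likelihood_ratio.

(** * Recurrence for the weights, and derivatives *)

(** Stated over the integers, since [n - k - m + j + 1] may be negative; both weights vanish in that
    case. *)
Lemma hyp_weight_ratio (n k m j : nat) : (k <= n)%N ->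
  (hyp_weight n k m j.+1)%:Z * (j.+1%:Z * (n%:Z - k%:Z - m%:Z + j%:Z + 1)) =
  (hyp_weight n k m j)%:Z * ((k%:Z - j%:Z) * (m%:Z - j%:Z)).
Proof.
move=> kn; rewrite /hyp_weight; case: ltngtP => [jm|mj|->]; last 2 first.
- by rewrite !mul0r.
- by rewrite subrr !mulr0 mul0r.
have bl a b : 'C(a, b.+1)%:Z * b.+1%:Z = 'C(a, b)%:Z * (a%:Z - b%:Z).
  have [ba|ab] := leqP b a.
    by rewrite subzn// -!PoszM mulnC mul_bin_left mulnC.
  by rewrite !bin_small ?mul0r// ltnS ltnW.
have h := bl (n - k)%N (m - j.+1)%N.
rewrite -[(m - j)%N]subnSK// !PoszM.
have E1 : (m - j.+1)%:Z = m%:Z - j%:Z - 1 by rewrite -subzn//; lia.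
have E2 : ((m - j.+1).+1)%:Z = m%:Z - j%:Z by lia.
have E3 : (n - k)%:Z = n%:Z - k%:Z by rewrite -subzn.
rewrite E1 E2 E3 in h.
rewrite mulrACA bl [RHS]mulrACA; congr (_ * _).
by rewrite h; congr (_ * _); ring.
Qed.

Lemma is_derive_moebius_scaled {R : realType} (a c t : R) : 1 + a * t != 0 ->
  is_derive t (1 : R) (fun s => moebius a s / c) ((1 + a * t) ^- 2 / c).
Proof.
move=> h; rewrite /moebius.
have d1 : is_derive t (1 : R) (fun s : R => 1 + a * s) a.
  by apply: is_derive_eq; rewrite /GRing.scale/=; ring.
have d2 := @is_deriveV R (fun s : R => 1 + a * s) _ _ _ h d1.
have d3 := is_deriveM (is_derive_id t (1 : R)) d2.
have d4 := is_deriveM d3 (is_derive_cst c^-1 t (1 : R)).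
apply: (@is_derive_eq _ _ _ _ _ _ _ _ d4).
rewrite /GRing.scale/=; move: (c^-1) => c'.
by field.
Qed.

Lemma is_derive_lin_shift {R : realType} (g : R -> R) (A B t dg dg1 : R) :
  is_derive t (1 : R) g dg -> is_derive (t + 1) (1 : R) g dg1 ->
  is_derive t (1 : R) (fun s => B * g (s + 1) - A * g s) (B * dg1 - A * dg).
Proof.
move=> d0 d1.
have ds : is_derive t (1 : R) (fun s : R => s + 1) 1.
  by apply: is_derive_eq; rewrite addr0.
have d2 := @is_derive1_comp R g (fun s : R => s + 1) t _ _ d1 ds.
have d3 := is_deriveB (is_deriveM (is_derive_cst B t (1 : R)) d2)
  (is_deriveM (is_derive_cst A t (1 : R)) d0).
apply: (@is_derive_eq _ _ _ _ _ _ _ _ d3).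
by rewrite /GRing.scale/=; ring.
Qed.

Lemma le_of_derive_ge0 {R : realType} (f df : R -> R) (a b : R) : a <= b ->
  (forall s, a <= s <= b -> is_derive s (1 : R) f (df s)) ->
  (forall s, a <= s <= b -> 0 <= df s) -> f a <= f b.
Proof.
move=> ab dF df0.
have oc s : s \in `]a, b[ -> a <= s <= b.
  by rewrite in_itv/= => /andP[/ltW -> /ltW ->].
apply: (@ger0_derive1_le_cc _ f a b) => //.
- by move=> s /oc sab; exact: (@ex_derive _ _ _ _ _ _ _ (dF s sab)).
- move=> s /oc sab; rewrite derive1E (@derive_val _ _ _ _ _ _ _ (dF s sab)).
  exact: df0.
- apply: derivable_within_continuous => s; rewrite in_itv/= => sab.
  exact: (@ex_derive _ _ _ _ _ _ _ (dF s sab)).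
- by rewrite in_itv/= lexx.
- by rewrite in_itv/= lexx andbT.
Qed.

(** * Hypergeometric tails against the Moebius transform of a normal law *)

Section hypergeometric_tail.
Context {R : realType}.
Variables n k m : nat.
Hypothesis (n_ge : 100 * 200 <= n%:R :> R).
Hypotheses (k_ge : (n%:R / 3 <= k%:R :> R)) (k_le : k%:R <= 2 / 3 * n%:R :> R).
Hypotheses (m_ge : (n%:R / 3 <= m%:R :> R)) (m_le : m%:R <= 2 / 3 * n%:R :> R).

Let w j : R := (hyp_weight n k m j)%:R.
Local Notation N := (n%:R : R).
Local Notation a := (100 / N).

Definition hyp_center (j : nat) : R := j%:R - k%:R * m%:R / n%:R.
(** The hypergeometric variance with [n] in place of [n - 1]; in this form its inverse is exactly
    the sum of the inverses of [P1], [P2], [P3], [P4]. *)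
Definition hyp_var : R :=
  k%:R * (n%:R - k%:R) * (m%:R * (n%:R - m%:R)) / n%:R ^+ 3.
(** [n / 100] is the limit of [moebius (100 / n)] at infinity; dividing by the square root passes to
    the scale of [Z]. *)
Definition hyp_window : R := n%:R / 100 / Num.sqrt hyp_var.
Definition hyp_map (t : R) : R := moebius (100 / n%:R) t / Num.sqrt hyp_var.

Local Notation x := hyp_center.
Local Notation v := hyp_var.
Local Notation L := hyp_window.
Local Notation psi := hyp_map.

Let N_ge : 100 * 200 <= N. Proof. exact: n_ge. Qed.
Let N0 : 0 < N. Proof. by have := N_ge; lra. Qed.
Let kn : (k <= n)%N. Proof. by rewrite -(ler_nat R); have := N0; move: k_le; lra. Qed.
Let mn : (m <= n)%N. Proof. by rewrite -(ler_nat R); have := N0; move: m_le; lra. Qed.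

(** [P1] to [P4] are the expected cell counts of the 2 by 2 table with margins [k] and [m]. The
    factors of the weight ratio are [P1 - x], [P2 - x], [P3 + x + 1], [P4 + x + 1]. *)
Let P1 : R := k%:R * (N - m%:R) / N.
Let P2 : R := m%:R * (N - k%:R) / N.
Let P3 : R := k%:R * m%:R / N.
Let P4 : R := (N - k%:R) * (N - m%:R) / N.

Let P_bound (u u' : R) : N / 3 <= u -> N / 3 <= u' -> u <= N -> u' <= N ->
  N / 9 <= u * u' / N <= N.
Proof.
have N1 := N0; move=> h h' l l'; rewrite ler_pdivlMr// ler_pdivrMr//; apply/andP; split; nra.
Qed.

Let P1_bound : N / 9 <= P1 <= N.
Proof. by apply: P_bound; move: N0 k_ge k_le m_ge m_le; lra. Qed.
Let P2_bound : N / 9 <= P2 <= N.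
Proof. by apply: P_bound; move: N0 k_ge k_le m_ge m_le; lra. Qed.
Let P3_bound : N / 9 <= P3 <= N.
Proof. by apply: P_bound; move: N0 k_ge k_le m_ge m_le; lra. Qed.
Let P4_bound : N / 9 <= P4 <= N.
Proof. by apply: P_bound; move: N0 k_ge k_le m_ge m_le; lra. Qed.

Let PP : P1 * P2 = P3 * P4.
Proof. by rewrite /P1 /P2 /P3 /P4; field; rewrite gt_eqF. Qed.

Let qbound (u : R) : N / 3 <= u -> u <= 2 / 3 * N ->
  2 / 9 * N ^+ 2 <= u * (N - u) <= N ^+ 2 / 4.
Proof.
have N1 := N0; move=> h h'; apply/andP; split.
  have : 0 <= (u - N / 3) * (2 / 3 * N - u) by apply: mulr_ge0; lra.
  nra.
have : 0 <= (u - N / 2) ^+ 2 by exact: sqr_ge0.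
nra.
Qed.

Lemma hyp_var_bounds : 4 * N / 81 <= v <= N / 16.
Proof.
have N1 := N0; have /andP[a1 a2] := qbound k_ge k_le.
have /andP[b1 b2] := qbound m_ge m_le.
have N3 : 0 < N ^+ 3 by rewrite exprn_gt0.
have N2 : 0 < N ^+ 2 by rewrite exprn_gt0.
rewrite /hyp_var ler_pdivlMr// ler_pdivrMr//; apply/andP; split.
  have -> : 4 * N / 81 * N ^+ 3 = (2 / 9 * N ^+ 2) * (2 / 9 * N ^+ 2) by field.
  by apply: ler_pM => //; nra.
have -> : N / 16 * N ^+ 3 = (N ^+ 2 / 4) * (N ^+ 2 / 4) by field.
by apply: ler_pM => //; nra.
Qed.

Let v0 : 0 < v.
Proof. by have := N0; have /andP[h _] := hyp_var_bounds; lra. Qed.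

Let sv0 : 0 < Num.sqrt v. Proof. by rewrite sqrtr_gt0. Qed.

Let vinv : v^-1 = P1^-1 + P2^-1 + P3^-1 + P4^-1.
Proof.
rewrite /hyp_var /P1 /P2 /P3 /P4; field.
by do ?[apply/andP; split]; rewrite gt_eqF//; move: N0 k_ge k_le m_ge m_le; lra.
Qed.

Let xE1 j : P1 - x j = k%:R - j%:R.
Proof. by rewrite /P1 /hyp_center; field; rewrite gt_eqF. Qed.
Let xE2 j : P2 - x j = m%:R - j%:R.
Proof. by rewrite /P2 /hyp_center; field; rewrite gt_eqF. Qed.
Let xE3 j : P3 + x j + 1 = j.+1%:R.
Proof. by rewrite /P3 /hyp_center -natr1; field; rewrite gt_eqF. Qed.
Let xE4 j : P4 + x j + 1 = N - k%:R - m%:R + j%:R + 1.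
Proof. by rewrite /P4 /hyp_center; field; rewrite gt_eqF. Qed.

Let w_ratio j : w j.+1 * ((P3 + x j + 1) * (P4 + x j + 1)) =
  w j * ((P1 - x j) * (P2 - x j)).
Proof.
rewrite xE1 xE2 xE3 xE4 /w.
have /(congr1 (intr : int -> R)) := hyp_weight_ratio m j kn.
by rewrite !(rmorphM, rmorphD, rmorphB, rmorphN)/= -!pmulrn.
Qed.

Let density_step j t : x j - 30 <= t <= x j - 29 -> - (N / 200) <= t ->
  (j <= k)%N -> (j <= m)%N ->
  (P1 - x j) * (P2 - x j) * moebius_density a v t <=
  (P3 + x j + 1) * (P4 + x j + 1) * moebius_density a v (t + 1).
Proof.
move=> tx tN jk jm; apply: ratio_moebius_density => //.
- exact: hyp_var_bounds.
- by rewrite xE1 subr_ge0 ler_nat.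
- by rewrite xE2 subr_ge0 ler_nat.
Qed.

Let a0 : 0 < a. Proof. by rewrite divr_gt0. Qed.
Let aN : a * N = 100. Proof. by rewrite mulfVK ?gt_eqF. Qed.

Let half t : - (N / 200) <= t -> - 2^-1 <= a * t.
Proof.
move=> ht; have : 0 <= a * (t + N / 200) by apply: mulr_ge0; [exact: ltW|lra].
have h := aN; have -> : a * (t + N / 200) = a * t + a * N / 200 by ring.
by lra.
Qed.

Let psi_le s t : - (N / 200) <= s -> s <= t -> psi s <= psi t.
Proof.
move=> sN st; rewrite ler_pM2r ?invr_gt0//.
by apply: moebius_le => //; exact: half.
Qed.

Let psi_le_window t : - (N / 200) <= t -> psi t <= L.
Proof.
move=> tN; rewrite ler_pM2r ?invr_gt0//.
have h := half tN; have h' := aN.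
rewrite /moebius ler_pdivrMr; last lra.
have -> : N / 100 * (1 + a * t) = N / 100 + a * N * t / 100 by ring.
by rewrite h'; have := N0; lra.
Qed.

Let psi_left : psi (- (N / 200)) = - L.
Proof.
rewrite /hyp_map /hyp_window -[RHS]mulNr; congr (_ / _).
rewrite /moebius.
have -> : 1 + a * - (N / 200) = 2^-1 by have := aN; rewrite mulrN mulrA; lra.
by rewrite invrK; lra.
Qed.

Let C : R := normal_peak 1 / Num.sqrt v.

Let G t := Phi (psi t).

Let is_derive_G t : - (N / 200) <= t ->
  is_derive t (1 : R) G (C * moebius_density a v t).
Proof.
move=> tN; have h := half tN.
have dM : is_derive t (1 : R) psi ((1 + a * t) ^- 2 / Num.sqrt v).
  apply: is_derive_moebius_scaled => //; lra.
rewrite /G.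
have dP := is_derive_Phi (psi t).
have D := @is_derive1_comp R Phi psi t _ _ dP dM.
apply: (@is_derive_eq _ _ _ _ _ _ _ _ D).
rewrite normal_pdfE ?oner_neq0// /normal_fun /moebius_density /C.
rewrite subr0 expr1n [in LHS]/hyp_map expr_div_n sqr_sqrtr ?(ltW v0)//.
have -> : - (moebius a t ^+ 2 / v) / (1 *+ 2) = - moebius a t ^+ 2 / (2 * v).
  by field; rewrite gt_eqF.
move: (expR _) (normal_peak _) ((Num.sqrt v)^-1) ((1 + a * t) ^- 2) => E p s D'.
by ring.
Qed.

(** Integrates [density_step] from [t] to [x j - 29]: [F] is nondecreasing there, its derivative
    being [C] times the difference of the two sides. *)
Let G_step j t : x j - 30 <= t -> - (N / 200) <= t -> t <= x j - 29 ->
  (j <= k)%N -> (j <= m)%N ->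
  (P1 - x j) * (P2 - x j) * (G (x j - 29) - G t) <=
  (P3 + x j + 1) * (P4 + x j + 1) * (G (x j - 28) - G (t + 1)).
Proof.
move=> t1 tN t2 jk jm; set A := (P1 - x j) * _; set B := (P3 + _ + _) * _.
pose F s := B * G (s + 1) - A * G s.
have dF s : - (N / 200) <= s -> is_derive s (1 : R) F
   (B * (C * moebius_density a v (s + 1)) - A * (C * moebius_density a v s)).
  move=> sN; have s1N : - (N / 200) <= s + 1 by lra.
  exact: is_derive_lin_shift (is_derive_G sN) (is_derive_G s1N).
suff : F t <= F (x j - 29).
  by rewrite /F (_ : x j - 29 + 1 = x j - 28); [lra|ring].
clearbody F.
apply: (@le_of_derive_ge0 R F (fun s => B * (C * moebius_density a v (s + 1)) -
  A * (C * moebius_density a v s)) t (x j - 29) t2).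
  by move=> s /andP[s1 _]; apply: dF; exact: le_trans s1.
move=> s /andP[s1 s2]; rewrite mulrCA (mulrCA A) -mulrBr; apply: mulr_ge0.
  by rewrite /C divr_ge0 ?normal_peak_ge0 ?sqrtr_ge0.
rewrite subr_ge0; apply: density_step; [|exact: le_trans s1|exact: jk|exact: jm].
by rewrite s2 andbT; exact: le_trans s1.
Qed.

Let cut t := Num.max t (- (N / 200)).

(** Cell boundaries of the comparison law on the indices up to [k], shifted by [30]. Cells left of
    [- n / 200] are empty, and the last cell receives all the mass up to [Phi L]. *)
Let e j : R := if (j <= k)%N then G (cut (x j - 30)) else Phi L.

Let xS j : x j.+1 = x j + 1.
Proof. by rewrite /hyp_center -natr1; ring. Qed.

Let cut_ge t : - (N / 200) <= cut t. Proof. by rewrite /cut le_max lexx orbT. Qed.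

Let e_le j : e j <= e j.+1.
Proof.
rewrite /e; have [jk|jk] := leqP j k; last by rewrite [(j < k)%N]ltnNge ltnW.
case: ifP => _; rewrite Phi_leE.
  apply: psi_le; first exact: cut_ge.
  by rewrite /cut ge_max !le_max lexx orbT andbT xS; apply/orP; left; lra.
by apply: psi_le_window; exact: cut_ge.
Qed.

Let e0 : e 0 = Phi (- L).
Proof.
(* [x 0 = - P3 <= - n / 9] lies left of the cut. *)
rewrite /e leq0n /G /cut max_r ?psi_left// /hyp_center.
by have := N0; have := P3_bound; rewrite /P3; lra.
Qed.

(** The cell masses [q], of total [Phi L - Phi (- L)], dominate [w] in the likelihood ratio order;
    the tails are compared with the two totals cross-multiplied. *)
Lemma hyp_tail_le j : (j <= k)%N -> - (N / 200) <= x j - 30 ->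
  (\sum_(j <= i < k.+1) w i) * (Phi L - Phi (- L)) <=
  (\sum_(0 <= i < k.+1) w i) * (Phi L - Phi (psi (x j - 30))).
Proof.
move=> jk jN.
pose q i := e i.+1 - e i.
have sq i : (i <= k.+1)%N -> \sum_(i <= l < k.+1) q l = e k.+1 - e i.
  by move=> ik; rewrite telescope_sumr.
have ek : e k.+1 = Phi L by rewrite /e ltnn.
have -> : Phi L - Phi (- L) = \sum_(0 <= l < k.+1) q l by rewrite sq// ek e0.
have -> : Phi L - Phi (psi (x j - 30)) = \sum_(j <= l < k.+1) q l.
  by rewrite sq ?leqW// ek /e jk /G /cut max_l.
(* The predicate selects the indices whose cell, from [x i - 30] to [x i - 29], is not entirely cut
   away. *)
rewrite [leRHS]mulrC; apply: (@likelihood_ratio_tail R k w q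
  (fun i => - (N / 200) < x i - 29) _ _ _ _ _ j (leqW jk)).
- by move=> i; rewrite /w ler0n.
- by move=> i; rewrite /q subr_ge0 e_le.
- by move=> i; rewrite xS; lra.
- move=> i ik; rewrite -leNgt => iN.
  rewrite /q /e ik (ltnW ik) xS /cut !max_r ?subrr//; lra.
move=> i ik iN.
have [i0 i1] : 0 < P3 + x i + 1 /\ 0 < P4 + x i + 1.
  have := N_ge; have /andP[h3 _] := P3_bound; have /andP[h4 _] := P4_bound.
  by move=> ?; split; lra.
have [im|im] := leqP i m; last first.
  exists 0 => //; rewrite !mul0r /w /hyp_weight.
  by rewrite [(i < m)%N]ltnNge ltnW//= subr_ge0 e_le.
have [u1 u2] : 0 <= P1 - x i /\ 0 <= P2 - x i.
  by rewrite xE1 xE2 !subr_ge0 !ler_nat (ltnW ik).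
exists ((P1 - x i) * (P2 - x i) / ((P3 + x i + 1) * (P4 + x i + 1))).
  by rewrite divr_ge0// ?mulr_ge0// ltW.
split.
  rewrite mulrAC ler_pdivlMr ?mulr_gt0// [leRHS]mulrC.
  by rewrite w_ratio.
rewrite mulrAC ler_pdivrMr ?mulr_gt0// [leRHS]mulrC.
pose t := cut (x i - 30).
have tN : - (N / 200) <= t by exact: cut_ge.
have t30 : x i - 30 <= t by rewrite /t /cut le_max lexx.
have t29 : t <= x i - 29 by rewrite /t /cut ge_max (ltW iN) andbT; lra.
have x29 : x i.+1 - 30 = x i - 29 by rewrite xS; ring.
have x28 : x i.+2 - 30 = x i - 28 by rewrite !xS; ring.
have qi : q i = G (x i - 29) - G t.
  by rewrite /q /e ik (ltnW ik) -/t x29 /cut max_l// ltW.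
rewrite qi.
apply: le_trans (G_step t30 tN t29 (ltnW ik) im) _.
apply: ler_wpM2l; first by rewrite mulr_ge0// ltW.
(* The cell of [i] may be cut, but that of [i + 1] is complete: as [t + 1 >= x i - 29], the
   translate of the former lies in the latter. *)
apply: (@le_trans _ _ (G (x i - 28) - G (x i - 29))).
  by rewrite lerD2l lerN2 Phi_leE; apply: psi_le; lra.
rewrite /q {2}/e ik x29 /cut (max_l (ltW iN)) lerD2r /e.
(* When [i + 1 = k], the last cell reaches up to [Phi L], which only adds mass. *)
case: ifP => _; last by rewrite Phi_leE; apply: psi_le_window; lra.
by rewrite x28 /cut max_l//; lra.
Qed.

End hypergeometric_tail.

(** * Range and sign symmetry of the hypergeometric law *)

Lemma hyp_center_norm_le {R : realType} (n k m j : nat) : (0 < n)%N ->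
  (k <= n)%N -> (m <= n)%N -> (j <= k)%N -> `|hyp_center n k m j : R| <= n%:R.
Proof.
move=> n0 kn mn jk; have N0 : 0 < n%:R :> R by rewrite ltr0n.
have h : 0 <= k%:R * m%:R / n%:R :> R by rewrite divr_ge0 ?mulr_ge0.
have h' : k%:R * m%:R / n%:R <= n%:R :> R.
  by rewrite ler_pdivrMr//; apply: ler_pM; rewrite ?ler_nat.
have j0 : 0 <= j%:R :> R by [].
have jn : j%:R <= n%:R :> R by rewrite ler_nat (leq_trans jk).
by rewrite /hyp_center ler_norml; apply/andP; split; lra.
Qed.

(** Exchange of plus and minus signs. Where only one of the two guards holds, the binomial it
    protects vanishes. *)
Lemma hyp_weight_sym n k m j : (k <= n)%N -> (m <= n)%N -> (j <= k)%N ->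
  hyp_weight n k (n - m) (k - j) = hyp_weight n k m j.
Proof.
move=> kn mn jk; rewrite /hyp_weight bin_sub//.
have [jm|mj] := leqP j m; have [h|h] := leqP (k - j)%N (n - m)%N => //.
- have -> : (n - m - (k - j) = n - k - (m - j))%N by lia.
  by rewrite bin_sub//; lia.
- by rewrite (@bin_small (n - k) (m - j)) ?muln0//; lia.
- by rewrite (@bin_small (n - k)) ?muln0//; lia.
Qed.

Lemma hyp_center_sym {R : realType} n k m j : (0 < n)%N -> (m <= n)%N -> (j <= k)%N ->
  hyp_center n k (n - m) (k - j) = - hyp_center n k m j :> R.
Proof.
move=> n0 mn jk; rewrite /hyp_center !natrB//; field.
by rewrite pnatr_eq0 -lt0n.
Qed.

Lemma hyp_var_sym {R : realType} n k m : (m <= n)%N ->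
  hyp_var n k (n - m) = hyp_var n k m :> R.
Proof. by move=> mn; rewrite /hyp_var natrB//; ring. Qed.

(** * Subgaussian moment generating function *)

Section hyp_mgf.
Context {R : realType}.
Variables n k m : nat.
Hypotheses (n0 : (0 < n)%N) (kn : (k <= n)%N) (mn : (m <= n)%N).

Let w j : R := (hyp_weight n k m j)%:R.
Let x : nat -> R := hyp_center n k m.

Let xS j : x j.+1 = x j + 1.
Proof. by rewrite /x /hyp_center -natr1; ring. Qed.

Let x_bound j : (j <= k)%N -> x j ^+ 2 <= n%:R ^+ 2.
Proof.
move=> jk; rewrite -[leLHS]real_normK ?num_real// lerXn2r ?nnegrE//.
exact: hyp_center_norm_le.
Qed.

Let ratio_x j :
  w j.+1 * (j.+1%:R * (n%:R - k%:R - m%:R + j.+1%:R)) =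
  w j * ((k%:R - j%:R) * (m%:R - j%:R)).
Proof.
have /(congr1 (intr : int -> R)) := hyp_weight_ratio m j kn.
rewrite !(rmorphM, rmorphD, rmorphB, rmorphN)/= -!pmulrn /w => <-.
by rewrite -natr1; ring.
Qed.

(* Summation by parts against the ratio of consecutive weights: tilting by
   [expR (l * x)] gives [S1 = O(n l) S0] without knowing the weights. *)
Lemma hyp_tilted_mean (l : R) : 0 <= l <= 2^-1 ->
  \sum_(0 <= j < k.+1) w j * expR (l * x j) * x j <=
  4 * n%:R * l * \sum_(0 <= j < k.+1) w j * expR (l * x j).
Proof.
move=> /andP[l0 l1].
pose E j := w j * expR (l * x j).
have E0 j : 0 <= E j by rewrite mulr_ge0 ?expR_ge0 ?ler0n.
pose h j := E j * (j%:R * (n%:R - k%:R - m%:R + j%:R)).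
have hS j : h j.+1 = expR l * (E j * ((k%:R - j%:R) * (m%:R - j%:R))).
  rewrite /h /E xS mulrDr mulr1 expRD.
  transitivity (expR (l * x j) * expR l *
     (w j.+1 * (j.+1%:R * (n%:R - k%:R - m%:R + j.+1%:R)))); first by ring.
  by rewrite ratio_x; ring.
have h0 : h 0 = 0 by rewrite /h mul0r mulr0.
have hk : h k.+1 = 0.
  rewrite /h /E /w /hyp_weight bin_small// mul0n.
  by case: ifP => _; rewrite !mul0r.
have sumE : \sum_(0 <= j < k.+1) h j.+1 = \sum_(0 <= j < k.+1) h j.
  have := @big_nat_recl R 0 +%R k.+1 0 h (leq0n _).
  by rewrite big_nat_recr//= hk addr0 h0 add0r => ->.
set S0 := \sum_(0 <= j < k.+1) E j; set S1 := \sum_(0 <= j < k.+1) _.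
pose S2 := \sum_(0 <= j < k.+1) E j * x j ^+ 2.
have N0 : 0 < n%:R :> R by rewrite ltr0n.
pose p : R := k%:R * (n%:R - m%:R) / n%:R + m%:R * (n%:R - k%:R) / n%:R.
pose q : R := k%:R * m%:R * (n%:R - k%:R) * (n%:R - m%:R) / n%:R ^+ 2.
have kR : 0 <= (k%:R : R) <= n%:R by rewrite ler0n ler_nat.
have mR : 0 <= (m%:R : R) <= n%:R by rewrite ler0n ler_nat.
have p0 : 0 <= p.
  by case/andP: kR => ? ?; case/andP: mR => ? ?;
     rewrite addr_ge0// divr_ge0// ?mulr_ge0//; lra.
have qn : q <= n%:R ^+ 2.
  case/andP: kR => ? ?; case/andP: mR => ? ?.
  rewrite /q ler_pdivrMr ?exprn_gt0//.
  have -> : n%:R ^+ 2 * n%:R ^+ 2 = n%:R * n%:R * n%:R * n%:R :> R by ring.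
  apply: ler_pM; [rewrite !mulr_ge0//; lra | lra | | lra].
  apply: ler_pM; [rewrite !mulr_ge0//; lra | lra | | lra].
  by apply: ler_pM.
(* In terms of [x], both products in [h] and [hS] are monic quadratics with constant term [q]; their
   linear coefficients are [n - p] and [- p]. *)
have key : (expR l - 1) * (q * S0 + S2) = (expR l * p + (n%:R - p)) * S1.
  apply/eqP; rewrite -subr_eq0; apply/eqP.
  transitivity (\sum_(0 <= j < k.+1) (h j.+1 - h j)); last first.
    by rewrite sumrB sumE subrr.
  rewrite /S0 /S1 /S2 !mulr_sumr -big_split/= mulr_sumr -sumrB.
  apply: eq_bigr => j _; rewrite hS /h -/(E j).
  have -> : j%:R = x j + k%:R * m%:R / n%:R by rewrite /x /hyp_center; ring.
  move: (x j) (E j) (expR l) => y e b.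
  by rewrite /p /q; field; rewrite gt_eqF.
have b1 : 1 <= expR l by rewrite -expR0 ler_expR.
have b2 : expR l <= 1 + 2 * l.
  have lt1 : 0 < 1 - l by lra.
  have := expR_ge1Dx (- l); rewrite expRN => hl.
  have : expR l <= (1 - l)^-1 by rewrite -[leLHS]invrK lef_pV2 ?posrE ?invr_gt0 ?expR_gt0.
  move=> /le_trans; apply; rewrite -[leLHS]mul1r ler_pdivrMr//; nra.
have S00 : 0 <= S0 by apply: sumr_ge0.
have S2n : S2 <= n%:R ^+ 2 * S0.
  rewrite /S2 /S0 mulr_sumr !big_nat; apply: ler_sum => j /andP[_ jk].
  by rewrite mulrC; apply: ler_wpM2r => //; apply: x_bound.
have q0 : 0 <= q.
  case/andP: kR => ? ?; case/andP: mR => ? ?.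
  by rewrite divr_ge0 ?sqr_ge0// !mulr_ge0//; lra.
have S20 : 0 <= S2 by apply: sumr_ge0 => j _; rewrite mulr_ge0 ?sqr_ge0.
have c0 : n%:R <= expR l * p + (n%:R - p).
  have : 0 <= (expR l - 1) * p by rewrite mulr_ge0//; lra.
  lra.
have S10 : 0 <= S1.
  rewrite -(@pmulr_rge0 _ (expR l * p + (n%:R - p))); last by lra.
  by rewrite -key; apply: mulr_ge0; [lra|apply: addr_ge0 => //; exact: mulr_ge0].
have : n%:R * S1 <= n%:R * (4 * n%:R * l * S0).
  apply: (@le_trans _ _ ((expR l - 1) * (q * S0 + S2))).
    by rewrite key; apply: ler_wpM2r.
  apply: (@le_trans _ _ ((2 * l) * (n%:R ^+ 2 * S0 + n%:R ^+ 2 * S0))).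
    apply: ler_pM; [lra | by apply: addr_ge0 => //; exact: mulr_ge0 | lra |].
    by apply: lerD => //; exact: ler_wpM2r.
  by rewrite le_eqVlt; apply/orP; left; apply/eqP; ring.
by rewrite ler_pM2l.
Qed.

(** Gronwall: the tilted mean bound reads [f' <= 4 n s f], so [f s * exp (- 2 n s ^ 2)] is
    nonincreasing. *)
Lemma hyp_mgf_le (l : R) : 0 <= l <= 2^-1 ->
  \sum_(0 <= j < k.+1) w j * expR (l * x j) <=
  expR (2 * n%:R * l ^+ 2) * \sum_(0 <= j < k.+1) w j.
Proof.
move=> l01; pose f (s : R) := \sum_(j < k.+1) w j * expR (s * x j).
pose df (s : R) := \sum_(j < k.+1) w j * expR (s * x j) * x j.
pose g (s : R) := expR (- (2 * n%:R * s ^+ 2)).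
have dF (s : R) : is_derive s (1 : R) f (df s).
  have -> : f = \sum_(j < k.+1) (fun s => w j * expR (s * x j)).
    by apply/funext => y; rewrite fct_sumE.
  apply: is_derive_sum => j.
  have d1 : is_derive s (1 : R) (fun y : R => y * x j) (x j).
    by apply: is_derive_eq; rewrite /GRing.scale/=; ring.
  have d2 := @is_derive1_comp R expR (fun y : R => y * x j) s _ _ (is_derive_expR _) d1.
  have d3 := is_deriveM (is_derive_cst (w j) s (1 : R)) d2.
  apply: (@is_derive_eq _ _ _ _ _ _ _ _ d3).
  by rewrite /GRing.scale/=; ring.
have dG (s : R) : is_derive s (1 : R) g (- (4 * n%:R * s) * g s).
  have d1 : is_derive s (1 : R) (fun y : R => - (2 * n%:R * y ^+ 2)) (- (4 * n%:R * s)).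
    have d0 := is_deriveM (is_derive_id s (1 : R)) (is_derive_id s (1 : R)).
    have d2 := is_deriveN (is_deriveM (is_derive_cst (2 * n%:R : R) s (1 : R)) d0).
    apply: (@is_derive_eq _ _ _ _ _ _ _ _ d2).
    by rewrite /GRing.scale/=; ring.
  have d2 := @is_derive1_comp R expR _ s _ _ (is_derive_expR _) d1.
  by apply: (@is_derive_eq _ _ _ _ _ _ _ _ d2); rewrite mulrC.
have H : - (f 0 * g 0) <= - (f l * g l).
  apply: (@le_of_derive_ge0 R (fun s => - (f s * g s))
    (fun s => g s * (4 * n%:R * s * f s - df s)) 0 l).
  - by case/andP: l01.
  - move=> s _; have d2 := is_deriveN (is_deriveM (dF s) (dG s)).
    apply: (@is_derive_eq _ _ _ _ _ _ _ _ d2).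
    by rewrite /GRing.scale/=; ring.
  - move=> s /andP[s0 sl]; rewrite mulr_ge0 ?expR_ge0// subr_ge0.
    have := @hyp_tilted_mean s; rewrite !big_mkord; apply.
    by rewrite s0/=; case/andP: l01 => _; exact: le_trans.
have f0 : f 0 = \sum_(0 <= j < k.+1) w j.
  by rewrite big_mkord; apply: eq_bigr => j _; rewrite mul0r expR0 mulr1.
have g0 : g 0 = 1 by rewrite /g expr0n/= mulr0 oppr0 expR0.
rewrite -f0 big_mkord -/(f l).
move: H; rewrite g0 mulr1 lerN2 /g expRN => H.
by rewrite [leRHS]mulrC -ler_pdivrMr ?expR_gt0.
Qed.

End hyp_mgf.

Definition mk_RV {d : measure_display} {T : measurableType d} {R : realType}
    (P : probability T R) (f : T -> R) (mf : measurable_fun setT f) :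
    {RV P >-> R} :=
  HB.pack_for {mfun T >-> R} f (isMeasurableFun.Build _ _ _ _ f mf).

Lemma mk_RVE {d : measure_display} {T : measurableType d} {R : realType}
    (P : probability T R) (f : T -> R) (mf : measurable_fun setT f) :
  mk_RV P mf = f :> (T -> R).
Proof. by []. Qed.

(** * Quantile transform of the normal law restricted to a set *)

Section gaussian_quantile.
Context {R : realType}.
Local Notation N := (normal_prob (0 : R) 1).

Lemma Phi_near0 (e : R) : 0 < e -> exists z : R, Phi z < e.
Proof.
move=> e0; have := cvg_cdfNy0 (mk_RV N (@measurable_id _ (measurableTypeR R) setT)).
move=> /fine_cvgP[_]; rewrite /comp /cdf /distribution /pushforward /= => h.
have /(_ _ _ e0) := @cvgr_lt _ _ _ _ _ _ h.
move=> [M [_ HM]]; exists (M - 1); apply: HM; lra.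
Qed.

Lemma Phi_near1 (e : R) : 0 < e -> exists z : R, 1 - e < Phi z.
Proof.
move=> e0; have := cvg_cdfy1 (mk_RV N (@measurable_id _ (measurableTypeR R) setT)).
move=> /fine_cvgP[_]; rewrite /comp /cdf /distribution /pushforward /= => h.
have e1 : 1 - e < 1 by lra.
have /(_ _ _ e1) := @cvgr_gt _ _ _ _ _ _ h.
move=> [M [_ HM]]; exists (M + 1); apply: HM; lra.
Qed.

Variable D : set (measurableTypeR R).
Hypothesis mD : measurable D.

Definition cum (z : R) : R := fine (N (D `&` `]-oo, z])).

Let cumE z : N (D `&` `]-oo, z]) = (cum z)%:E.
Proof. by rewrite /cum fineK// normal_prob_fin_num//; exact: measurableI. Qed.

Let ND : R := fine (N D).
Let NDE : N D = ND%:E.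
Proof. by rewrite /ND fineK// normal_prob_fin_num. Qed.

(** [cum] inherits continuity from [Phi] through this domination. *)
Lemma cum_increment x y : x <= y -> 0 <= cum y - cum x <= Phi y - Phi x.
Proof.
move=> xy.
have E : N (D `&` `]-oo, y]) = (N (D `&` `]-oo, x]) + N (D `&` `]x, y]))%E.
  rewrite -measureU//; try exact: measurableI.
    by rewrite -setIUr -itv_bndbnd_setU.
  apply/seteqP; split => z //=; rewrite !in_itv/= => -[[_ zx] [_ /andP[xz _]]].
  by move: (lt_le_trans xz zx); rewrite ltxx.
have f : N (D `&` `]x, y]) \is a fin_num.
  by apply: normal_prob_fin_num; exact: measurableI.
move: E; rewrite !cumE -(fineK f) -EFinD => -[->].
rewrite addrC addKr fine_ge0//= -lee_fin fineK// -normal_prob_itv_oc//.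
by apply: le_measure; rewrite ?inE//; exact: measurableI.
Qed.

Lemma cum_le : {homo cum : x y / x <= y}.
Proof. by move=> x y /cum_increment/andP[]; rewrite subr_ge0. Qed.

Lemma cum_le_Phi z : cum z <= Phi z.
Proof.
rewrite -lee_fin -cumE -normal_probNyE; apply: le_measure; rewrite ?inE//.
exact: measurableI.
Qed.

Lemma cum_le_total z : cum z <= ND.
Proof. by rewrite -lee_fin -cumE -NDE; apply: le_measure; rewrite ?inE//; exact: measurableI. Qed.

Lemma total_le_cum z : ND <= cum z + (1 - Phi z).
Proof.
have E : N D = (N (D `&` `]-oo, z]) + N (D `&` `]z, +oo[))%E.
  rewrite -measureU//; try exact: measurableI.
    by rewrite -setIUr -itv_bndbnd_setU// set_itvE setIT.
  apply/seteqP; split => t //=; rewrite !in_itv/= => -[[_ zx] [_ /andP[xz _]]].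
  by move: (lt_le_trans xz zx); rewrite ltxx.
rewrite -lee_fin -NDE E cumE EFinD leeD2l//.
have -> : (1 - Phi z)%:E = N (~` `]-oo, z]).
  by rewrite probability_setC//= EFinD EFinN -normal_probNyE.
rewrite setCitvl; apply: le_measure; rewrite ?inE//; exact: measurableI.
Qed.

Lemma continuous_cum : continuous cum.
Proof.
move=> x; apply/cvgrPdist_lt => e e0.
have /cvgrPdist_lt/(_ e e0) := @continuous_Phi R x.
apply: filterS => y; apply: le_lt_trans.
have [xy|yx] := leP x y.
  have /andP[h1 h2] := cum_increment xy.
  by rewrite distrC ger0_norm// distrC ger0_norm//; lra.
have /andP[h1 h2] := cum_increment (ltW yx).
by rewrite ger0_norm// ger0_norm//; lra.
Qed.

Lemma measurable_cum_le c : measurable [set z : measurableTypeR R | cum z <= c].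
Proof.
have : measurable_fun setT cum by apply: continuous_measurable_fun; exact: continuous_cum.
move=> /(_ measurableT [set` `]-oo, c]] (measurable_itv _)); rewrite setTI.
by congr measurable; apply/seteqP; split => z /=; rewrite in_itv.
Qed.

(** Probability integral transform on [D]. The sublevel set is the whole line, empty, or a half-line
    ending at its supremum, where [cum] equals [c] by continuity. *)
Lemma normal_prob_cum_le c : 0 <= c <= ND ->
  N (D `&` [set z | cum z <= c]) = c%:E.
Proof.
move=> /andP[c0 c1]; set E := [set z | _].
have [[b Eb]|Eub] := pselect (has_ubound E); last first.
  have ET : E = setT.
    apply/seteqP; split => // z _; apply: contrapT => zE.
    apply: Eub; exists z => y /= yE; rewrite leNgt; apply/negP => /ltW/cum_le zy.
    by apply: zE; exact: le_trans yE.
  rewrite ET setIT NDE; congr EFin; apply/eqP; rewrite eq_le c1 andbT.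
  apply/ler_addgt0Pr => e e0; have [z hz] := Phi_near1 e0.
  have : E z by rewrite ET.
  by have := total_le_cum z; rewrite /E /=; lra.
have [[y Ey]|Ey] := pselect (E !=set0); last first.
  have E0 : E = set0 by apply/seteqP; split => // z Ez; apply: Ey; exists z.
  rewrite E0 setI0 measure0; congr EFin; apply/eqP; rewrite eq_le c0/=.
  apply/ler_addgt0Pr => e e0; have [z hz] := Phi_near0 e0.
  have : ~ E z by rewrite E0.
  by rewrite /E /= => /negP; rewrite -ltNge; have := cum_le_Phi z; lra.
have supE : has_sup E by split; [exists y|exists b].
pose z1 := sup E.
have cz1 : cum z1 = c.
  apply/eqP; rewrite eq_le; apply/andP; split; rewrite leNgt; apply/negP => h.
    have /(_ _ _ h) := @cvgr_gt _ _ _ _ _ _ (@continuous_cum z1).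
    move=> /nbhs_ballP[e /= e0 he].
    have [u Eu hu] := sup_adherent e0 supE.
    have uz : u <= z1 by exact: (ub_le_sup supE.2).
    have /he : ball z1 e u.
      by rewrite /ball/= ger0_norm ?subr_ge0//; move: hu; rewrite -/z1; lra.
    by move: Eu; rewrite /E/=; lra.
  have /(_ _ _ h) := @cvgr_lt _ _ _ _ _ _ (@continuous_cum z1).
  move=> /nbhs_ballP[e /= e0 he].
  have /he h2 : ball z1 e (z1 + e / 2).
    by rewrite /ball/= opprD addNKr normrN ger0_norm; lra.
  have : z1 + e / 2 <= z1.
    by apply: (ub_le_sup supE.2); rewrite /E/= ltW.
  lra.
have -> : E = [set` `]-oo, z1]].
  apply/seteqP; split => z /=; rewrite in_itv/=.
    by move=> Ez; apply: (ub_le_sup supE.2).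
  by move=> /cum_le; rewrite cz1.
by rewrite cumE cz1.
Qed.

Variables (K : nat) (p : nat -> R).
Hypothesis p0 : forall j, 0 <= p j.
Hypothesis p1 : \sum_(0 <= j < K.+1) p j = 1.

Let Pi j : R := \sum_(0 <= i < j) p i.

Let Pi_le i j : (i <= j)%N -> Pi i <= Pi j.
Proof.
move=> ij; rewrite /Pi (big_cat_nat (n := i) (m := 0) (p := j))//= lerDl.
by apply: sumr_ge0.
Qed.

Let Pi01 j : (j <= K.+1)%N -> 0 <= Pi j <= 1.
Proof.
move=> jK; apply/andP; split; first by apply: sumr_ge0.
by rewrite -p1; exact: Pi_le.
Qed.

Let ND_ge0 : 0 <= ND. Proof. by rewrite /ND fine_ge0. Qed.

(** The conditional quantile given [D], not normalised. A failed search in [iota 0 K] returns [K],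
    the right value because [Pi K.+1 = 1]. *)
Definition qrank (z : R) : nat :=
  find (fun j => cum z <= ND * Pi j.+1) (iota 0 K).

Lemma qrank_le z : (qrank z <= K)%N.
Proof. by rewrite -[leqRHS](size_iota 0 K) find_size. Qed.

Lemma qrank_ub z : cum z <= ND * Pi (qrank z).+1.
Proof.
have := qrank_le z; rewrite leq_eqVlt => /predU1P[->|rK].
  by rewrite /Pi p1 mulr1 cum_le_total.
have : has (fun j => cum z <= ND * Pi j.+1) (iota 0 K).
  by rewrite has_find size_iota.
by move=> /(nth_find 0%N); rewrite -/(qrank z) nth_iota.
Qed.

Lemma qrank_lb z : (0 < qrank z)%N -> ND * Pi (qrank z) < cum z.
Proof.
move=> r0; have rr : ((qrank z).-1 < qrank z)%N by rewrite prednK.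
have := before_find 0%N rr; rewrite nth_iota ?add0n ?prednK// => [/negbT|].
  by rewrite -ltNge.
by rewrite ?prednK ?qrank_le.
Qed.

Lemma qrank_geE j z : (0 < j <= K)%N ->
  (j <= qrank z)%N = (ND * Pi j < cum z).
Proof.
move=> /andP[j0 jK]; apply/idP/idP => [jr|h].
  apply: le_lt_trans (qrank_lb (leq_trans j0 jr)).
  by apply: ler_wpM2l => //; exact: Pi_le.
rewrite leqNgt; apply/negP => rj; move: h; rewrite ltNge => /negP; apply.
by apply: le_trans (qrank_ub z) _; apply: ler_wpM2l => //; exact: Pi_le.
Qed.

Lemma normal_prob_qrank_ge j : (j <= K.+1)%N ->
  measurable [set z : measurableTypeR R | (j <= qrank z)%N] /\
  N (D `&` [set z | (j <= qrank z)%N]) = (ND * (1 - Pi j))%:E.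
Proof.
move=> jK; have [j0|j0] := posnP j.
  rewrite j0 /Pi big_nil subr0 mulr1 (_ : [set z | _] = setT) ?setIT//.
  by apply/seteqP; split.
move: jK; rewrite leq_eqVlt => /predU1P[->|jK].
  rewrite /Pi p1 subrr mulr0 (_ : [set z | _] = set0) ?setI0 ?measure0//.
  by apply/seteqP; split => // z /=; rewrite ltnNge qrank_le.
rewrite ltnS in jK.
have -> : [set z : measurableTypeR R | (j <= qrank z)%N] =
    ~` [set z | cum z <= ND * Pi j].
  apply/seteqP; split => z /=; rewrite qrank_geE ?j0// ltNge => /negP.
    by [].
  by [].
split; first by apply: measurableC; exact: measurable_cum_le.
have jK' : (j <= K.+1)%N by exact: leqW.
have /andP[a0 a1] := Pi01 jK'.
set E := [set z | cum z <= _]; have -> : N (D `&` ~` E) = (N D - N (D `&` E))%E.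
  rewrite -setDE; apply: measureD => //; first exact: measurable_cum_le.
  by rewrite -ge0_fin_numE//; exact: normal_prob_fin_num.
rewrite /E normal_prob_cum_le; last first.
  by rewrite mulr_ge0//= ler_piMr.
by rewrite NDE -EFinB mulrBr mulr1.
Qed.

Lemma normal_prob_qrank j : (j <= K)%N ->
  measurable [set z : measurableTypeR R | qrank z = j] /\
  N (D `&` [set z | qrank z = j]) = (ND * p j)%:E.
Proof.
move=> jK; have [m1 e1] := normal_prob_qrank_ge (leqW jK).
have [m2 e2] := @normal_prob_qrank_ge j.+1 jK.
have E : [set z : measurableTypeR R | qrank z = j] =
    [set z | (j <= qrank z)%N] `\` [set z | (j.+1 <= qrank z)%N].
  apply/seteqP; split => z /=.
    by move=> ->; rewrite leqnn ltnn.
  by move=> [h1 /negP]; rewrite -leqNgt => h2; apply/eqP; rewrite eqn_leq h1 h2.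
split; first by rewrite E; exact: measurableD.
have : N (D `&` [set z | (j <= qrank z)%N]) =
   (N (D `&` [set z | qrank z = j]) + N (D `&` [set z | (j.+1 <= qrank z)%N]))%E.
  rewrite -measureU//.
  - rewrite -setIUr; congr (N (D `&` _)); apply/seteqP; split => z /=.
      by rewrite leq_eqVlt => /predU1P[->|]; [left|right].
    by case=> [->|/ltnW].
  - by apply: measurableI => //; rewrite E; exact: measurableD.
  - exact: measurableI.
  - by apply/seteqP; split => z //= -[[_ ->] [_]]; rewrite ltnn.
have f : N (D `&` [set z | qrank z = j]) \is a fin_num.
  apply: normal_prob_fin_num; apply: measurableI => //.
  by rewrite E; exact: measurableD.
rewrite e1 e2 -(fineK f) -EFinD => -[h]; congr EFin; move: h.
rewrite /Pi big_nat_recr//=; nra.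
Qed.

End gaussian_quantile.

(** * Gluing the quantile couplings inside and outside the window *)

Section gaussian_coupling.
Context {R : realType}.
Local Notation N := (normal_prob (0 : R) 1).
Variables (K : nat) (p : nat -> R) (L : R).
Hypothesis p0 : forall j, 0 <= p j.
Hypothesis p1 : \sum_(0 <= j < K.+1) p j = 1.

(* Conditionally on either of [`]-L, L]] and its complement the law of [iota]
   is [p]; on the former [iota] is moreover the conditional quantile. *)
Lemma gaussian_coupling : exists iota : measurableTypeR R -> nat,
  [/\ forall z, (iota z <= K)%N,
      forall j, measurable [set z | iota z = j],
      forall j, (j <= K)%N -> N [set z | iota z = j] = (p j)%:E &
      forall z, - L < z <= L ->
        (Phi L - Phi (- L)) * \sum_(0 <= i < iota z) p i < Phi z - Phi (- L) <=
        (Phi L - Phi (- L)) * \sum_(0 <= i < (iota z).+1) p i].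
Proof.
pose J : set (measurableTypeR R) := [set` `]- L, L]].
have mJ : measurable J by exact: measurable_itv.
have mJC : measurable (~` J) by exact: measurableC.
pose r1 := qrank J K p; pose r2 := qrank (~` J) K p.
have r1K z : (r1 z <= K)%N by exact: qrank_le.
have r2K z : (r2 z <= K)%N by exact: qrank_le.
pose iota z := if `[< J z >] then r1 z else r2 z.
have iotaE j : [set z | iota z = j] =
   (J `&` [set z | r1 z = j]) `|` (~` J `&` [set z | r2 z = j]).
  apply/seteqP; split => z /=; rewrite /iota; case: asboolP => h.
  - by move=> <-; left.
  - by move=> <-; right.
  - by case=> -[].
  - by case=> -[].
exists iota; split.
- by move=> z; rewrite /iota; case: ifP.
- move=> j; have [jK|jK] := leqP j K; last first.
    rewrite (_ : [set z | _] = set0)//; apply/seteqP; split => // z /= zj.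
    by move: jK; rewrite -zj ltnNge /iota; case: ifP => _; rewrite ?r1K ?r2K.
  rewrite iotaE; apply: measurableU; apply: measurableI => //.
    by have [] := normal_prob_qrank mJ p0 p1 jK.
  by have [] := normal_prob_qrank mJC p0 p1 jK.
- move=> j jK; rewrite iotaE.
  have [m1 e1] := normal_prob_qrank mJ p0 p1 jK.
  have [m2 e2] := normal_prob_qrank mJC p0 p1 jK.
  rewrite measureU//; [|exact: measurableI|exact: measurableI|]; last first.
    by apply/seteqP; split => z //= -[[? _] []].
  rewrite [X in (X + _)%E]e1 [X in (_ + X)%E]e2 -EFinD -mulrDl.
  congr EFin; rewrite -[RHS]mul1r; congr (_ * _).
  rewrite -fineD ?normal_prob_fin_num//.
  rewrite -measureU//; last by rewrite setICr.
  by rewrite setUCr; exact: (congr1 fine (probability_setT (normal_prob (0 : R) 1))).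
move=> z zL.
have Jz : J z by rewrite /J/= in_itv.
have LL : - L <= L by case/andP: zL => h1 h2; apply: ltW; exact: lt_le_trans h2.
rewrite /iota; case: asboolP => // _.
have NJ : fine (N J) = Phi L - Phi (- L) by rewrite /J normal_prob_itv_oc.
have cz : cum J z = Phi z - Phi (- L).
  rewrite /cum (_ : J `&` _ = [set` `]- L, z]]).
    by rewrite normal_prob_itv_oc//; case/andP: zL => /ltW.
  apply/seteqP; split => t; rewrite /J /= !in_itv/=.
    by move=> [/andP[-> _]].
  by move=> /andP[-> tz]; case/andP: zL => _ zL; rewrite (le_trans tz).
have := qrank_ub mJ p1 z; rewrite cz NJ => ->; rewrite andbT.
have [r0|r0] := posnP (r1 z).
  by rewrite r0 big_nil mulr0 subr_gt0 Phi_ltE; case/andP: zL.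
by have := qrank_lb r0; rewrite cz NJ.
Qed.

End gaussian_coupling.

(** * Law of the conditioned walk, by counting sign patterns *)

Lemma measure_bigsetU_seq {d : measure_display} {T : measurableType d}
    {R : realType} (mu : {measure set T -> \bar R}) (I : choiceType) (r : seq I)
    (F : I -> set T) : uniq r -> (forall i, measurable (F i)) ->
  (forall i j, i != j -> F i `&` F j = set0) ->
  mu (\big[setU/set0]_(i <- r) F i) = (\sum_(i <- r) mu (F i))%E.
Proof.
move=> + mF dF; elim: r => [_|i r IH /= /andP[ir ur]].
  by rewrite !big_nil measure0.
rewrite !big_cons -IH//; apply: measureU => //; first exact: bigsetU_measurable.
rewrite -subset0 => t [Fit]; rewrite -bigcup_seq => -[j /= jr Fjt].
have ij : i != j by apply: contra ir => /eqP ->.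
by have : (F i `&` F j) t by []; rewrite (dF _ _ ij).
Qed.

Section walk_law.
Context {R : realType} {d : measure_display} {T : measurableType d}.
Variables (P : probability T R) (X : nat -> {RV P >-> R}).
Hypothesis hX : iid_fair_signs X.
Variable n : nat.

(** The sign pattern is extended to all of [nat], because independence is stated for families of
    sets indexed by [nat]. *)
Let sgn (B : {set 'I_n}) (i : nat) : R :=
  if [exists j : 'I_n, (j == i :> nat) && (j \in B)] then 1 else -1.

Let sgnE B (i : 'I_n) : sgn B i = if i \in B then 1 else -1.
Proof.
rewrite /sgn; case: existsP => [[j /andP[/eqP/val_inj -> ->]]//|h].
by case: ifP => // iB; case: h; exists i; rewrite eqxx.
Qed.

Let cell (B : {set 'I_n}) : set T :=
  \bigcap_(i in [set` iota 0 n]) (X i @^-1` [set sgn B i]).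

Let cellP B t : cell B t <-> forall i : 'I_n, X i t = if i \in B then 1 else -1.
Proof.
split=> [h i|h i /=]; first by rewrite -sgnE; apply: h => /=; rewrite mem_iota/=.
by rewrite mem_iota/= => ilt; rewrite (h (Ordinal ilt)) -sgnE.
Qed.

Let mcell B : measurable (cell B).
Proof.
apply: bigcap_measurableType => // i _.
Qed.

Let Pcell B : P (cell B) = (2 ^- n)%:E.
Proof.
have [indep fair] := hX.
rewrite (indep (iota 0 n) (fun i => [set sgn B i]))//; last exact: iota_uniq.
rewrite (eq_bigr (fun _ => (2^-1)%:E)); last first.
  by move=> i _; rewrite /sgn; have [f1 f2] := fair i; case: ifP.
by rewrite -[X in iota 0 X]subn0 -/(index_iota 0 n) big_mkord prodEFin prodr_const card_ord exprVn.
Qed.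

Let cell_disjoint B C : B != C -> cell B `&` cell C = set0.
Proof.
move=> BC; rewrite -subset0 => t [/cellP hB /cellP hC]; apply: (negP BC).
apply/eqP/finset.setP => i; have := hB i; rewrite hC.
have n1 : (1 : R) != -1 by apply/eqP; lra.
case: (i \in B); case: (i \in C) => h; [reflexivity| | |reflexivity].
  by rewrite h eqxx in n1.
by rewrite -h eqxx in n1.
Qed.

Let cells := \big[setU/set0]_(B <- enum {set 'I_n}) cell B.

(** There are [2 ^ n] disjoint cells of mass [2 ^- n]; values of the steps other than [1] and [-1]
    are thereby confined to a null set. *)
Let Pcells : P cells = 1%E.
Proof.
rewrite /cells (measure_bigsetU_seq P (enum_uniq _) mcell cell_disjoint).
rewrite (eq_bigr (fun _ => (2 ^- n)%:E)); last by move=> B _; exact: Pcell.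
rewrite sumEFin big_const_seq count_predT -cardE iter_addr_0.
have -> : #|{: {set 'I_n}}| = (2 ^ n)%N by rewrite -cardsT -finset.powersetT card_powerset cardsT card_ord.
by rewrite -[_ *+ _]mulr_natr natrX mulVf// expf_neq0.
Qed.

Let mcells : measurable cells.
Proof. exact: bigsetU_measurable. Qed.

(** Reduces a probability to a count: up to a null set, [F] is the union of the cells selected by
    [f]. *)
Lemma walk_event_prob (F : set T) (f : pred {set 'I_n}) : measurable F ->
  (forall B t, cell B t -> F t <-> f B) ->
  P F = (2 ^- n * #|f|%:R)%:E.
Proof.
move=> mF Ff.
have P0 : P (~` cells) = 0%E by rewrite probability_setC// Pcells subee.
have -> : P F = P (F `&` cells).
  rewrite -[in LHS](setIT F) -(setUv cells) setIUr measureU//.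
  - rewrite [X in (_ + X)%E](_ : _ = 0%E) ?adde0//.
    apply/eqP; rewrite -measure_le0 -P0 le_measure ?inE//.
    + by apply: measurableI => //; exact: measurableC.
    + exact: measurableC.
  - exact: measurableI.
  - by apply: measurableI => //; exact: measurableC.
  - by rewrite -subset0 => t [[_ ?] [_]].
have mFc B : measurable (F `&` cell B) by exact: measurableI.
have dFc B C : B != C -> (F `&` cell B) `&` (F `&` cell C) = set0.
  by move=> BC; rewrite setIACA cell_disjoint// setI0.
rewrite /cells -bigcup_seq setI_bigcupr bigcup_seq.
rewrite (measure_bigsetU_seq P (enum_uniq _) mFc dFc).
rewrite big_enum/= (eq_bigr (fun B => (2 ^- n * (f B)%:R)%:E)).
    rewrite sumEFin -mulr_sumr -natr_sum -sum1_card; congr (_ * _%:R)%:E.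
    by rewrite [in RHS]big_mkcond; apply: eq_bigr => B _; rewrite -topredE/=; case: (f B).
  move=> B _; have [fB|fB] := boolP (f B).
    rewrite mulr1 -(Pcell B); congr (P _); apply/seteqP; split => [t [_ //]|t Bt].
    by split=> //; apply/(Ff B t).
  rewrite mulr0 (_ : F `&` cell B = set0) ?measure0//.
  rewrite -subset0 => t [Ft Bt]; apply: (negP fB); exact/(Ff B t).
Qed.

Let walk_cell B t k : cell B t -> (k <= n)%N ->
  walk X k t = 2 * #|B :&: prefix_set n k|%SET%:R - k%:R.
Proof.
move=> /cellP Bt kn; rewrite /walk (big_ord_widen n (fun i => X i t) kn).
rewrite (eq_bigr (fun i : 'I_n => 2 * (i \in B)%:R - 1)); last first.
  by move=> i _; rewrite Bt; case: (i \in B) => /=; ring.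
rewrite big_split/= -mulr_sumr sumrN; congr (_ * _ - _).
  rewrite -natr_sum -sum1_card; congr _%:R.
  rewrite big_mkcond [RHS]big_mkcond; apply: eq_bigr => i _.
  by rewrite !inE; case: (i \in B); case: ltnP.
rewrite -[X in _ = X%:R](card_prefix_set kn) -sum1_card natr_sum.
by apply: eq_bigl => i; rewrite inE.
Qed.

Lemma measurable_walk k : measurable_fun setT (walk X k).
Proof. exact: measurable_sum. Qed.

Lemma measurable_walk_event k s : measurable (walk_event X k s).
Proof.
rewrite -[X in measurable X]setTI /walk_event.
exact: (@measurable_walk k measurableT [set s%:~R] (measurable_set1 _)).
Qed.

(** On the cell of [B] the walk ends at [2 * #|B| - n], so for any other [s] no cell is counted. *)
Lemma probable_valueP s : probable_value X n s ->
  exists2 m, (m <= n)%N & s = 2 * m%:Z - n%:Z.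
Proof.
rewrite /probable_value => h; apply: contrapT => hs.
move: h; rewrite (@walk_event_prob _ pred0).
- by rewrite card0 mulr0 ltxx.
- exact: measurable_walk_event.
move=> B t Bt; split => //; rewrite /walk_event/= (walk_cell Bt (leqnn n)) => E.
exfalso; apply: hs; exists #|B|; first by rewrite -[X in (_ <= X)%N]card_ord max_card.
apply: (@intr_inj R); rewrite -E rmorphB rmorphM/= -!pmulrn.
congr (_ * _%:R - _); apply: eq_card => i; rewrite !inE ltn_ord andbT//.
Qed.

Lemma bridge_prob k m (A : set R) : (k <= n)%N -> measurable A ->
  P (walk X k @^-1` A `&` walk_event X n (2 * m%:Z - n%:Z)) =
  (2 ^- n * \sum_(0 <= j < k.+1)
     (hyp_weight n k m j)%:R * \1_A (2 * j%:R - k%:R))%:E.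
Proof.
move=> kn mA.
pose f := [pred B : {set 'I_n} |
  (#|B| == m) && (2 * #|B :&: prefix_set n k|%SET%:R - k%:R \in A)].
rewrite (@walk_event_prob _ f).
- congr (_ * _)%:E.
  have -> : #|f|%:R = \sum_(B : {set 'I_n} | #|B| == m) (\1_A (2 * #|B :&: prefix_set n k|%SET%:R - k%:R) : R).
    rewrite -sum1_card natr_sum big_mkcond [RHS]big_mkcond; apply: eq_bigr => B _.
    by rewrite -topredE/= indicE; case: (_ == m); case: (_ \in A).
  have bk (B : {set 'I_n}) : (#|B :&: prefix_set n k|%SET < k.+1)%N.
    by rewrite ltnS -[X in (_ <= X)%N](card_prefix_set kn) subset_leq_card// finset.subsetIr.
  rewrite (partition_big (fun B : {set 'I_n} => Ordinal (bk B)) predT)//= big_mkord.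
  apply: eq_bigr => j _.
  rewrite -card_hyp_weight//.
  rewrite (eq_bigr (fun=> \1_A (2 * j%:R - k%:R))); last first.
    by move=> B /andP[_ /eqP <-].
  rewrite sumr_const [RHS]mulr_natl; congr (_ *+ _); apply: eq_card => B.
- apply: measurableI; last exact: measurable_walk_event.
  by rewrite -[X in measurable X]setTI; exact: measurable_walk.
move=> B t Bt; rewrite /walk_event/= (walk_cell Bt kn) (walk_cell Bt (leqnn n)).
have -> : (B :&: prefix_set n n)%SET = B.
  by apply/finset.setP => i; rewrite !inE ltn_ord andbT.
split.
  move=> [h1 h2]; rewrite mem_set// andbT.
  apply/eqP; apply: (@mulrIn R 1) => //.
  by move: h2; rewrite rmorphB rmorphM/= -!pmulrn => /addIr; lra.
by move=> /andP[/eqP <- /set_mem ?]; split => //; rewrite rmorphB rmorphM/= -!pmulrn.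
Qed.

Lemma bridge_distributionE k m (A : set R) : (k <= n)%N -> measurable A ->
  bridge_distribution X n k (2 * m%:Z - n%:Z) A =
  ((\sum_(0 <= j < k.+1) (hyp_weight n k m j)%:R * \1_A (2 * j%:R - k%:R)) /
   (\sum_(0 <= j < k.+1) (hyp_weight n k m j)%:R))%:E.
Proof.
move=> kn mA; rewrite /bridge_distribution /cond_distribution bridge_prob//.
(* The denominator becomes the case [A = setT] of [bridge_prob], and the factors [2 ^- n] cancel. *)
have -> : walk_event X n (2 * m%:Z - n%:Z) =
  walk X k @^-1` setT `&` walk_event X n (2 * m%:Z - n%:Z).
  by rewrite preimage_setT setTI.
rewrite bridge_prob//= -mulf_div divff ?mul1r ?invr_neq0 ?expf_neq0//.
congr ((_ / _)%:E); apply: eq_bigr => j _; by rewrite indicT mulr1.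
Qed.

Lemma hyp_total_gt0 k m : (k <= n)%N -> probable_value X n (2 * m%:Z - n%:Z) ->
  0 < \sum_(0 <= j < k.+1) (hyp_weight n k m j)%:R :> R.
Proof.
move=> kn; rewrite /probable_value.
have -> : walk_event X n (2 * m%:Z - n%:Z) =
  walk X k @^-1` setT `&` walk_event X n (2 * m%:Z - n%:Z).
  by rewrite preimage_setT setTI.
rewrite bridge_prob// lte_fin pmulr_rgt0 ?invr_gt0 ?exprn_gt0//.
rewrite (eq_bigr (fun j => (hyp_weight n k m j)%:R))// => j _.
by rewrite indicT mulr1.
Qed.

End walk_law.

(** * Integration of functions of a finitely valued variable *)

Section finitely_valued.
Context {d : measure_display} {T : measurableType d} {R : realType}.
Variables (mu : {measure set T -> \bar R}) (K : nat) (iota : T -> nat) (p : nat -> R).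
Hypothesis iotaK : forall z, (iota z <= K)%N.
Hypothesis miota : forall j, measurable [set z | iota z = j].
Hypothesis iotap : forall j, (j <= K)%N -> mu [set z | iota z = j] = (p j)%:E.

Let sum_indic (g : nat -> R) z :
  g (iota z) = \sum_(j < K.+1) g j * \1_[set z | iota z = j] z.
Proof.
have iz : (iota z < K.+1)%N by rewrite ltnS.
rewrite (bigD1 (Ordinal iz))//= big1 ?addr0.
  by rewrite indicE mem_set// mulr1.
move=> j jz; rewrite indicE memNset ?mulr0// => /= E.
by move/eqP: jz; apply; apply: val_inj.
Qed.

Lemma measurable_fun_finitely_valued (g : nat -> R) :
  measurable_fun setT (fun z => g (iota z)).
Proof.
rewrite (_ : (fun z => _) = fun z => \sum_(j < K.+1) g j * \1_[set z | iota z = j] z).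
  by apply: measurable_sum => j; apply: measurable_funM => //; exact: measurable_indic.
by apply/funext => z; exact: sum_indic.
Qed.

Lemma integral_finitely_valued (g : nat -> R) : (forall j, 0 <= g j) ->
  (\int[mu]_z (g (iota z))%:E)%E = (\sum_(0 <= j < K.+1) g j * p j)%:E.
Proof.
move=> g0.
transitivity (\int[mu]_z (\sum_(j < K.+1) (g j * \1_[set z | iota z = j] z)%:E))%E.
  by apply: eq_integral => z _; rewrite sumEFin -sum_indic.
rewrite ge0_integral_sum//; last 2 first.
- move=> j; apply/measurable_EFinP; apply: measurable_funM => //.
- by move=> j z _; rewrite lee_fin mulr_ge0.
rewrite big_mkord -sumEFin; apply: eq_bigr => j _.
under eq_integral do rewrite EFinM.
rewrite ge0_integralZl//; last 2 first.
- by apply/measurable_EFinP; exact: measurable_indic.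
- by rewrite lee_fin.
by rewrite integral_indic// setIT iotap// -ltnS.
Qed.

End finitely_valued.

Lemma big_nat_tail_rev {R : realType} (f : nat -> R) (k j : nat) : (j <= k)%N ->
  \sum_(k - j <= i < k.+1) f i = \sum_(0 <= i < j.+1) f (k - i)%N.
Proof.
move=> jk; rewrite big_nat_rev -{1}[(k - j)%N]add0n big_addn.
have -> : (k.+1 - (k - j) = j.+1)%N by lia.
by rewrite !big_nat; apply: eq_bigr => i /andP[_ ij]; congr f; lia.
Qed.

(** * Pointwise error of the quantile coupling *)

Section pointwise.
Context {R : realType}.

(** The inverse map is [y / (1 - a y)], and [(1 - a y) (y + 2 a y ^ 2) = y + a y ^ 2 (1 - 2 a y) >=
    y]. *)
Lemma moebius_inverse_le (a t y : R) : 0 <= a -> - 2^-1 <= a * t ->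
  `|a * y| <= 4^-1 -> moebius a t <= y -> t <= y + 2 * a * y ^+ 2.
Proof.
move=> a0 at2; rewrite ler_norml => /andP[ay1 ay2].
rewrite /moebius ler_pdivrMr; last lra.
move=> h; rewrite leNgt; apply/negP => ht.
have h1 : (1 - a * y) * (y + 2 * a * y ^+ 2) < (1 - a * y) * t.
  by rewrite ltr_pM2l//; lra.
have h2 : (1 - a * y) * (y + 2 * a * y ^+ 2) = y + a * y ^+ 2 * (1 - 2 * (a * y)) by ring.
have h3 : 0 <= a * y ^+ 2 * (1 - 2 * (a * y)).
  by apply: mulr_ge0; [apply: mulr_ge0 => //; exact: sqr_ge0|lra].
have h4 : (1 - a * y) * t <= y.
  have -> : (1 - a * y) * t = t - y * (a * t) by ring.
  rewrite mulrDr mulr1 in h; have : y * (a * t) = a * y * t by ring.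
  lra.
lra.
Qed.

Variables n k m : nat.
Hypothesis n_ge : 100 * 200 <= n%:R :> R.
Hypotheses (k_ge : (n%:R / 3 <= k%:R :> R)) (k_le : k%:R <= 2 / 3 * n%:R :> R).
Hypotheses (m_ge : (n%:R / 3 <= m%:R :> R)) (m_le : m%:R <= 2 / 3 * n%:R :> R).

Let w j : R := (hyp_weight n k m j)%:R.
Let S : R := \sum_(0 <= j < k.+1) w j.
Hypothesis S0 : 0 < S.
Local Notation v := (@hyp_var R n k m).
Local Notation x := (@hyp_center R n k m).
Local Notation L := (@hyp_window R n k m).

(** Combined with the tail comparison, the quantile inequality yields
    [hyp_map n k m (x j - 30) <= z]; inverting the Moebius map costs
    [2 (100 / n) v z ^ 2 <= 25 / 2 z ^ 2]. *)
Lemma quantile_upper_bound (z : R) (j : nat) : (j <= k)%N ->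
  `|Num.sqrt v * z| <= n%:R / 400 ->
  (Phi L - Phi (- L)) * (\sum_(0 <= i < j) w i / S) <= Phi z - Phi (- L) ->
  x j <= Num.sqrt v * z + 30 + 25 / 2 * z ^+ 2.
Proof.
move=> jk hz hq.
have /andP[vl vu] := hyp_var_bounds n_ge k_ge k_le m_ge m_le.
have nG := n_ge; have kG := k_ge; have kL := k_le; have mG := m_ge; have mL := m_le.
have n0 : 0 < n%:R :> R by lra.
have v0 : 0 < v by lra.
have sv0 : 0 < Num.sqrt v by rewrite sqrtr_gt0.
set y := Num.sqrt v * z in hz *.
have y2 : y ^+ 2 = v * z ^+ 2 by rewrite /y exprMn sqr_sqrtr// ltW.
have z20 : 0 <= z ^+ 2 by exact: sqr_ge0.
have [tN|tN] := leP (- (n%:R / 200)) (x j - 30); last first.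
  by move: hz; rewrite ler_norml => /andP[h1 h2]; lra.
have := hyp_tail_le n_ge k_ge k_le m_ge m_le jk tN.
have -> : \sum_(j <= i < k.+1) (hyp_weight n k m i)%:R = S - \sum_(0 <= i < j) w i.
  have jk1 := leqW jk; rewrite /S (big_cat_nat (n := j) (m := 0) (p := k.+1))//=.
  by rewrite [RHS]addrC addKr.
rewrite -[X in _ <= X * _]/S => ht.
have SS : S * \sum_(0 <= i < j) w i / S = \sum_(0 <= i < j) w i.
  by rewrite -mulr_suml mulrC divfK ?gt_eqF.
have : S * (Phi (hyp_map n k m (x j - 30))) <= S * Phi z.
  have : S * ((Phi L - Phi (- L)) * (\sum_(0 <= i < j) w i / S)) <=
     S * (Phi z - Phi (- L)) by rewrite ler_pM2l.
  rewrite mulrCA SS.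
  move: ht; set s := \sum_(0 <= i < j) w i.
  move: (Phi L) (Phi (- L)) (Phi z) (Phi _) => A B C D.
  by rewrite mulrBl !mulrBr; lra.
rewrite ler_pM2l// Phi_leE /hyp_map ler_pdivrMr// [leRHS]mulrC => hM.
have aN : 100 / n%:R * n%:R = 100 :> R by rewrite divfK ?gt_eqF.
have a0 : 0 < 100 / n%:R :> R by rewrite divr_gt0.
have : x j - 30 <= y + 2 * (100 / n%:R) * y ^+ 2.
  apply: moebius_inverse_le => //.
  - have : 0 <= 100 / n%:R * (x j - 30 + n%:R / 200).
      by apply: mulr_ge0; [exact: ltW|lra].
    rewrite mulrDr mulrA aN; lra.
  - rewrite normrM gtr0_norm//.
    have : 100 / n%:R * `|y| <= 100 / n%:R * (n%:R / 400) by rewrite ler_pM2l.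
    by rewrite mulrA aN; lra.
have : 2 * (100 / n%:R) * y ^+ 2 <= 25 / 2 * z ^+ 2.
  rewrite y2 [leLHS]mulrA; apply: ler_wpM2r => //.
  have : 100 / n%:R * v <= 100 / n%:R * (n%:R / 16) by rewrite ler_pM2l.
  by rewrite mulrA aN; lra.
lra.
Qed.

End pointwise.

Section pointwise_main.
Context {R : realType}.
Variables n k m : nat.
Hypothesis n_ge : 100 * 200 <= n%:R :> R.
Hypotheses (k_ge : (n%:R / 3 <= k%:R :> R)) (k_le : k%:R <= 2 / 3 * n%:R :> R).
Hypotheses (m_ge : (n%:R / 3 <= m%:R :> R)) (m_le : m%:R <= 2 / 3 * n%:R :> R).

Let w j : R := (hyp_weight n k m j)%:R.
Let S : R := \sum_(0 <= j < k.+1) w j.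
Hypothesis S0 : 0 < S.
Local Notation v := (@hyp_var R n k m).
Local Notation x := (@hyp_center R n k m).
Local Notation L := (@hyp_window R n k m).

Lemma quantile_coupling_bound (z : R) (j : nat) : (j <= k)%N ->
  (- L < z <= L ->
   (Phi L - Phi (- L)) * \sum_(0 <= i < j) w i / S < Phi z - Phi (- L) <=
   (Phi L - Phi (- L)) * \sum_(0 <= i < j.+1) w i / S) ->
  `|x j - Num.sqrt v * z| <= 30 + 100 * 101 * z ^+ 2.
Proof.
move=> jk hq.
have /andP[vl vu] := hyp_var_bounds n_ge k_ge k_le m_ge m_le.
have nG := n_ge; have kG := k_ge; have kL := k_le; have mG := m_ge; have mL := m_le.
have n0 : 0 < n%:R :> R by lra.
have n0' : (0 < n)%N by rewrite -(ltr0n R).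
have kn : (k <= n)%N by rewrite -(ler_nat R); lra.
have mn : (m <= n)%N by rewrite -(ler_nat R); lra.
have v0 : 0 < v by lra.
have sv0 : 0 < Num.sqrt v by rewrite sqrtr_gt0.
have z20 : 0 <= z ^+ 2 by exact: sqr_ge0.
have y2 : (Num.sqrt v * z) ^+ 2 = v * z ^+ 2 by rewrite exprMn sqr_sqrtr// ltW.
have [hy|hy] := leP `|Num.sqrt v * z| (n%:R / 400).
  have zL : - L < z <= L.
    have LE : Num.sqrt v * L = n%:R / 100.
      by rewrite /hyp_window mulrC divfK ?gt_eqF.
    move: hy; rewrite ler_norml => /andP[h1 h2].
    rewrite -(ltr_pM2l sv0) -[X in _ && X](ler_pM2l sv0) mulrN LE.
    by apply/andP; split; lra.
  have /andP[q1 q2] := hq zL.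
  have U := quantile_upper_bound n_ge k_ge k_le m_ge m_le S0 jk hy (ltW q1).
  have m_ge' : n%:R / 3 <= (n - m)%N%:R :> R by rewrite natrB//; lra.
  have m_le' : (n - m)%N%:R <= 2 / 3 * n%:R :> R by rewrite natrB//; lra.
  have wS i : (i <= k)%N -> (hyp_weight n k (n - m) (k - i))%:R = w i :> R.
    by move=> ik; rewrite hyp_weight_sym.
  have sum_sym i : (i <= k)%N ->
      \sum_(k - i <= l < k.+1) (hyp_weight n k (n - m) l)%:R = \sum_(0 <= l < i.+1) w l.
    move=> ik; rewrite big_nat_tail_rev// !big_nat; apply: eq_bigr => l /andP[_ li].
    by apply: wS; exact: leq_trans ik.
  have SE : \sum_(0 <= l < k.+1) (hyp_weight n k (n - m) l)%:R = S.
    by rewrite -[X in index_iota X](subnn k) sum_sym.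
  have S0' : 0 < \sum_(0 <= l < k.+1) (hyp_weight n k (n - m) l)%:R :> R by rewrite SE.
  have hy' : `|Num.sqrt (hyp_var n k (n - m)) * (- z)| <= n%:R / 400.
    by rewrite hyp_var_sym// mulrN normrN.
  have LL : hyp_window n k (n - m) = L by rewrite /hyp_window hyp_var_sym.
  (* The lower bound is the upper bound for the reflected data [n - m], [k - j], [- z]; the strict
     side of the quantile inequality served above, the other side serves here. *)
  have := @quantile_upper_bound R n k (n - m) n_ge k_ge k_le m_ge' m_le' S0' (- z)
    (k - j)%N (leq_subr _ _) hy'.
  rewrite hyp_var_sym// hyp_center_sym// sqrrN LL SE mulrN => /(_ _) U'.
  have {}U' : - x j <= - (Num.sqrt v * z) + 30 + 25 / 2 * z ^+ 2.
    apply: U'.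
    have -> : \sum_(0 <= i < k - j) (hyp_weight n k (n - m) i)%:R / S =
       1 - \sum_(0 <= i < j.+1) w i / S.
      rewrite -!mulr_suml; apply/eqP; rewrite eq_sym subr_eq -mulrDl; apply/eqP.
      rewrite -sum_sym// -big_cat_nat//=; last exact: leqW (leq_subr _ _).
      by rewrite SE divff ?gt_eqF.
    rewrite (Phi_symmetry (- z)) !opprK.
    move: q2; set s := \sum_(0 <= i < j.+1) _; rewrite mulrBr mulr1.
    move: (Phi L) (Phi (- L)) (Phi z) => A B C; lra.
  by rewrite ler_norml; apply/andP; split; lra.
have xb := hyp_center_norm_le (R := R) n0' kn mn jk.
set y := Num.sqrt v * z in hy y2 *.
(* From [(n / 400) ^ 2 <= v z ^ 2 <= n z ^ 2 / 16]: for such [z] both [x j] and [sqrt v * z] are of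
   order [z ^ 2] at most. *)
have hn2 : n%:R ^+ 2 <= n%:R * (100 * 100 * z ^+ 2).
  have : (n%:R / 400) ^+ 2 <= `|y| ^+ 2.
    by apply: lerXn2r; rewrite ?nnegrE ?ltW//; lra.
  rewrite real_normK ?num_real// y2.
  have : v * z ^+ 2 <= n%:R / 16 * z ^+ 2 by apply: ler_wpM2r.
  have -> : (n%:R / 400) ^+ 2 = n%:R ^+ 2 / (100 * 100 * 16) :> R by field.
  lra.
have hn : n%:R <= 100 * 100 * z ^+ 2.
  by rewrite -(ler_pM2l n0) -expr2.
have hy2 : `|y| <= 25 * z ^+ 2.
  have : `|y| ^+ 2 <= (25 * z ^+ 2) ^+ 2.
    rewrite real_normK ?num_real// y2.
    apply: (@le_trans _ _ (n%:R / 16 * z ^+ 2)); first exact: ler_wpM2r.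
    have -> : (25 * z ^+ 2) ^+ 2 = (100 * 100 * z ^+ 2) / 16 * z ^+ 2 by field.
    by apply: ler_wpM2r => //; lra.
  by rewrite ler_pXn2r ?nnegrE//; lra.
apply: (le_trans (ler_normB _ _)); lra.
Qed.

End pointwise_main.

(** * Exponential moments of quadratic functions of [Z] *)

Section exponential_moments.
Context {R : realType}.
Local Notation N := (normal_prob (0 : R) 1).

(** Absorbs the factor [2] of the Gaussian moment into [7 / 8] of the constant [1] allowed in the
    exponent. *)
Lemma two_le_expR (c : R) : 7 / 8 <= c -> 2 <= expR c.
Proof.
move=> hc; apply: (@le_trans _ _ (expR (7 / 8))); last by rewrite ler_expR.
have -> : 7 / 8 = 4%:R * (7 / 32) :> R by field.
rewrite expRM_natl.
apply: (@le_trans _ _ ((1 + 7 / 32) ^+ 4)); first lra.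
by rewrite lerXn2r// ?nnegrE ?expR_ge0 ?expR_ge1Dx//; lra.
Qed.

Lemma mulr_le_sqrD (a b : R) : a * b <= a ^+ 2 + b ^+ 2 / 4.
Proof. by have := sqr_ge0 (a - b / 2); nra. Qed.

Lemma normal_exp_sqr_le (c : R) (f : measurableTypeR R -> R) :
  measurable_fun setT f -> (forall z, f z <= c + 3 / 8 * z ^+ 2) ->
  (\int[N]_z (expR (f z))%:E <= (2 * expR c)%:E)%E.
Proof.
move=> mf fz.
apply: (@le_trans _ _ (\int[N]_z ((expR c)%:E * (expR (3 / 8 * z ^+ 2))%:E))%E).
  apply: ge0_le_integral => //.
  - by apply/measurable_EFinP; exact: measurableT_comp.
  - apply/measurable_EFinP; apply: measurable_funM => //.
    apply/measurableT_comp => //; apply: measurable_funM => //.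
  - by move=> z _; rewrite -EFinM lee_fin -expRD ler_expR.
rewrite ge0_integralZl//; last first.
  apply/measurable_EFinP; apply/measurableT_comp => //.
  by apply: measurable_funM => //; exact: measurable_funX.
by rewrite expectation_exp_sqr_normal -EFinM mulrC.
Qed.

End exponential_moments.

(** * From the hypergeometric scale to the bridge and [sigma] *)

Section bridge.
Context {R : realType}.
Variables n k m : nat.
Hypotheses (n0 : (0 < n)%N) (kn : (k <= n)%N) (mn : (m <= n)%N).
Local Notation sigma := (@bridge_sigma R n k).
Local Notation v := (@hyp_var R n k m).
Local Notation x := (@hyp_center R n k m).
Let s : R := 2 * m%:R - n%:R.

Let N0 : 0 < n%:R :> R. Proof. by rewrite ltr0n. Qed.
Let kR : 0 <= (k%:R : R) <= n%:R. Proof. by rewrite ler0n ler_nat. Qed.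
Let mR : 0 <= (m%:R : R) <= n%:R. Proof. by rewrite ler0n ler_nat. Qed.

Lemma bridge_sigma_sqr : sigma ^+ 2 = k%:R * (n%:R - k%:R) / n%:R.
Proof.
rewrite sqr_sqrtr; first by rewrite mulrC.
case/andP: kR => k0 k1; apply: mulr_ge0; first by rewrite invr_ge0 ltW.
by apply: mulr_ge0 => //; rewrite subr_ge0.
Qed.

Lemma bridge_sigma_sqr_le : sigma ^+ 2 <= n%:R / 4.
Proof.
rewrite bridge_sigma_sqr ler_pdivrMr//.
have := sqr_ge0 (k%:R - n%:R / 2 : R); nra.
Qed.

(** [(a - b) ^ 2 <= a ^ 2 - b ^ 2] for [0 <= b <= a], applied to [sigma ^ 2 - 4 v = sigma ^ 2 s ^ 2
    / n ^ 2] with [sigma ^ 2 <= n / 4]. *)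
Lemma bridge_sigma_hyp_var : (sigma - 2 * Num.sqrt v) ^+ 2 <= s ^+ 2 / n%:R.
Proof.
have v0 : 0 <= v.
  case/andP: kR => ? ?; case/andP: mR => ? ?.
  by rewrite /hyp_var divr_ge0 ?exprn_ge0 ?mulr_ge0 ?subr_ge0.
have E : sigma ^+ 2 - 4 * v = sigma ^+ 2 * (s ^+ 2 / n%:R ^+ 2).
  by rewrite bridge_sigma_sqr /hyp_var /s; field; rewrite gt_eqF.
have s0 : 0 <= sigma by rewrite sqrtr_ge0.
have b0 : 0 <= Num.sqrt v by rewrite sqrtr_ge0.
have b2 : Num.sqrt v ^+ 2 = v by rewrite sqr_sqrtr.
have r0 : 0 <= s ^+ 2 / n%:R ^+ 2 by rewrite divr_ge0 ?sqr_ge0 ?exprn_ge0.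
have sb : 2 * Num.sqrt v <= sigma.
  rewrite -(@ler_pXn2r _ 2) ?nnegrE ?mulr_ge0// exprMn b2.
  have : 0 <= sigma ^+ 2 * (s ^+ 2 / n%:R ^+ 2) by rewrite mulr_ge0 ?sqr_ge0.
  lra.
apply: (@le_trans _ _ (sigma ^+ 2 - 4 * v)).
  have h : 0 <= Num.sqrt v * (sigma - 2 * Num.sqrt v).
    by rewrite mulr_ge0// subr_ge0.
  rewrite -[X in _ <= _ - 4 * X]b2; move: (Num.sqrt v) h => b h; nra.
rewrite E; apply: (@le_trans _ _ (n%:R / 4 * (s ^+ 2 / n%:R ^+ 2))).
  by apply: ler_wpM2r => //; exact: bridge_sigma_sqr_le.
have -> : n%:R / 4 * (s ^+ 2 / n%:R ^+ 2) = (s ^+ 2 / n%:R) / 4.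
  by field; rewrite gt_eqF.
have : 0 <= s ^+ 2 / n%:R by rewrite divr_ge0 ?sqr_ge0// ltW.
lra.
Qed.

Lemma bridge_center j : 2 * j%:R - k%:R - s * k%:R / n%:R = 2 * x j.
Proof. by rewrite /s /hyp_center; field; rewrite gt_eqF. Qed.

Lemma bridge_exponent_small (theta z : R) j : 0 <= theta <= (100 * 200 * 100)^-1 ->
  (j <= k)%N -> n%:R < 100 * 200 :> R ->
  theta * `|2 * x j - sigma * z| <= 8^-1 + 3 / 8 * z ^+ 2.
Proof.
move=> /andP[t0 t1] jk nlt.
have xb := hyp_center_norm_le (R := R) n0 kn mn jk.
have s0 : 0 <= sigma by rewrite sqrtr_ge0.
have z2 : 0 <= z ^+ 2 by exact: sqr_ge0.
have h1 : `|2 * x j - sigma * z| <= 2 * n%:R + sigma * `|z|.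
  apply: le_trans (ler_normB _ _) _; rewrite !normrM (ger0_norm s0) ger0_norm//.
  by apply: lerD => //; rewrite ler_pM2l.
have h2 : theta * (sigma * `|z|) <= (theta * sigma) ^+ 2 + z ^+ 2 / 4.
  by rewrite mulrA -(@real_normK _ z) ?num_real//; exact: mulr_le_sqrD.
have h3 : (theta * sigma) ^+ 2 <= 16^-1.
  rewrite exprMn; have sl := bridge_sigma_sqr_le.
  have : theta ^+ 2 * sigma ^+ 2 <= (100 * 200 * 100)^-1 ^+ 2 * (100 * 200 / 4).
    apply: ler_pM; rewrite ?sqr_ge0//; last by lra.
    by apply: lerXn2r; rewrite ?nnegrE//; lra.
  lra.
have h4 : theta * (2 * n%:R) <= 16^-1.
  have : theta * (2 * n%:R) <= (100 * 200 * 100)^-1 * (2 * (100 * 200)).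
    by apply: ler_pM => //; lra.
  lra.
have : theta * `|2 * x j - sigma * z| <= theta * (2 * n%:R + sigma * `|z|).
  exact: ler_wpM2l.
rewrite mulrDr; lra.
Qed.

(** The coupling error takes [1 / 8 + z ^ 2 / 8], and replacing [2 sqrt v] by [sigma] takes
    [z ^ 2 / 4] besides the drift term. *)
Lemma bridge_exponent_main (theta z : R) j : 0 <= theta <= (100 * 200 * 100)^-1 ->
  `|x j - Num.sqrt v * z| <= 30 + 100 * 101 * z ^+ 2 ->
  theta * `|2 * x j - sigma * z| <=
  8^-1 + theta ^+ 2 * (s ^+ 2 / n%:R) + 3 / 8 * z ^+ 2.
Proof.
move=> /andP[t0 t1] hx.
have z2 : 0 <= z ^+ 2 by exact: sqr_ge0.
set D := sigma - 2 * Num.sqrt v.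
have h1 : `|2 * x j - sigma * z| <= 2 * (30 + 100 * 101 * z ^+ 2) + `|D| * `|z|.
  have -> : 2 * x j - sigma * z = 2 * (x j - Num.sqrt v * z) - D * z.
    by rewrite /D; ring.
  apply: le_trans (ler_normB _ _) _; rewrite (normrM D) normrM ger0_norm//.
  by rewrite lerD2r ler_pM2l.
have h2 : theta * (`|D| * `|z|) <= theta ^+ 2 * (s ^+ 2 / n%:R) + z ^+ 2 / 4.
  apply: (@le_trans _ _ ((theta * `|D|) ^+ 2 + z ^+ 2 / 4)).
    by rewrite mulrA -(@real_normK _ z) ?num_real//; exact: mulr_le_sqrD.
  rewrite lerD2r exprMn real_normK ?num_real//.
  by apply: ler_wpM2l; [exact: sqr_ge0|exact: bridge_sigma_hyp_var].
have h3 : theta * (2 * (30 + 100 * 101 * z ^+ 2)) <= 8^-1 + z ^+ 2 / 8.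
  have : theta * (2 * (30 + 100 * 101 * z ^+ 2)) <=
      (100 * 200 * 100)^-1 * (2 * (30 + 100 * 101 * z ^+ 2)).
    by apply: ler_wpM2r => //; lra.
  lra.
have : theta * `|2 * x j - sigma * z| <=
    theta * (2 * (30 + 100 * 101 * z ^+ 2) + `|D| * `|z|) by exact: ler_wpM2l.
rewrite mulrDr; lra.
Qed.

End bridge.

(** * Large drift: marginal bounds only *)

Section large_drift.
Context {R : realType}.
Local Notation N := (normal_prob (0 : R) 1).
Variables n k m : nat.
Hypotheses (n0 : (0 < n)%N) (kn : (k <= n)%N) (mn : (m <= n)%N).
Local Notation sigma := (@bridge_sigma R n k).
Local Notation x := (@hyp_center R n k m).
Let w j : R := (hyp_weight n k m j)%:R.
Let S : R := \sum_(0 <= j < k.+1) w j.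
Hypothesis S0 : 0 < S.

(** [exp (l |x|) <= exp (l x) + exp (- l x)]; the second sum is the first for [n - m]. *)
Lemma hyp_mgf_norm_le (l : R) : 0 <= l <= 2^-1 ->
  \sum_(0 <= j < k.+1) expR (l * `|x j|) * (w j / S) <= 2 * expR (2 * n%:R * l ^+ 2).
Proof.
move=> l01.
have H1 := hyp_mgf_le n0 kn mn l01.
have mn' : (n - m <= n)%N by exact: leq_subr.
have H2 := hyp_mgf_le n0 kn mn' l01.
have r (f : nat -> R) : \sum_(0 <= j < k.+1) f j = \sum_(0 <= j < k.+1) f (k - j)%N.
  by rewrite -{1}(subnn k) big_nat_tail_rev.
have E2 : \sum_(0 <= j < k.+1) (hyp_weight n k (n - m) j)%:R = S.
  rewrite r /S !big_nat; apply: eq_bigr => j /andP[_ jk].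
  by rewrite hyp_weight_sym.
have E3 : \sum_(0 <= j < k.+1)
    (hyp_weight n k (n - m) j)%:R * expR (l * hyp_center n k (n - m) j) =
    \sum_(0 <= j < k.+1) w j * expR (- (l * x j)).
  rewrite r !big_nat; apply: eq_bigr => j /andP[_ jk].
  by rewrite hyp_weight_sym// hyp_center_sym// mulrN.
rewrite E2 E3 in H2; rewrite -[X in _ <= _ * X]/S in H1.
apply: (@le_trans _ _ (S^-1 * (\sum_(0 <= j < k.+1) w j * expR (l * x j) +
   \sum_(0 <= j < k.+1) w j * expR (- (l * x j))))).
  rewrite -big_split/= mulr_sumr; apply: ler_sum => j _.
  have -> : expR (l * `|x j|) * (w j / S) = S^-1 * (w j * expR (l * `|x j|)) by ring.
  apply: ler_wpM2l; first by rewrite invr_ge0 ltW.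
  rewrite -mulrDr; apply: ler_wpM2l; first exact: ler0n.
  have [e1 e2] := (expR_ge0 (l * x j), expR_ge0 (- (l * x j))).
  by case: (ger0P (x j)) => _; rewrite ?mulrN; lra.
rewrite mulrC ler_pdivrMr//; lra.
Qed.

Variable iota : measurableTypeR R -> nat.
Hypothesis iotaK : forall z, (iota z <= k)%N.
Hypothesis miota : forall j, measurable [set z | iota z = j].
Hypothesis iotap : forall j, (j <= k)%N -> N [set z | iota z = j] = (w j / S)%:E.

(** [exp (A + B) <= (exp (2 A) + exp (2 B)) / 2] separates the marginals, whatever the joint law.
    The constant [32] is [2 * 4 ^ 2], from [hyp_mgf_norm_le] at [l = 4 theta]. *)
Lemma large_drift_bound (theta : R) : 0 <= theta <= 8^-1 ->
  (\int[N]_z (expR (theta * `|2 * x (iota z) - sigma * z|))%:E <=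
   (2 * expR (32 * n%:R * theta ^+ 2))%:E)%E.
Proof.
move=> /andP[t0 t1].
have s0 : 0 <= sigma by rewrite sqrtr_ge0.
pose f1 z := expR (4 * theta * `|x (iota z)|).
pose f2 (z : measurableTypeR R) := expR (2 * theta * sigma * `|z|).
have m1 : measurable_fun setT f1.
  exact: (@measurable_fun_finitely_valued _ _ R k iota iotaK miota
    (fun j => expR (4 * theta * `|x j|))).
have m2 : measurable_fun setT f2.
  by apply/measurableT_comp => //; apply: measurable_funM => //; exact: measurableT_comp.
have mD : measurable_fun setT (fun z : measurableTypeR R => theta * `|2 * x (iota z) - sigma * z|).
  apply: measurable_funM => //; apply/measurableT_comp => //.
  apply: measurable_funB; last exact: measurable_funM.
  exact: (@measurable_fun_finitely_valued _ _ R k iota iotaK miota (fun j => 2 * x j)).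
apply: (@le_trans _ _ (\int[N]_z ((2^-1)%:E * ((f1 z)%:E + (f2 z)%:E)))%E).
  apply: ge0_le_integral => //.
  - by apply/measurable_EFinP; exact: measurableT_comp.
  - by apply/measurable_EFinP; apply: measurable_funM => //; exact: measurable_funD.
  move=> z _; rewrite -EFinD -EFinM lee_fin.
  apply: (@le_trans _ _ (expR (2 * theta * `|x (iota z)|) * expR (theta * sigma * `|z|))).
    rewrite -expRD ler_expR.
    have : `|2 * x (iota z) - sigma * z| <= 2 * `|x (iota z)| + sigma * `|z|.
      by apply: le_trans (ler_normB _ _) _; rewrite !normrM (ger0_norm s0) ger0_norm.
    by move=> h; have := ler_wpM2l t0 h; lra.
  have -> : f1 z = expR (2 * theta * `|x (iota z)|) ^+ 2.
    by rewrite /f1 -expRM_natl; congr expR; ring.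
  have -> : f2 z = expR (theta * sigma * `|z|) ^+ 2.
    by rewrite /f2 -expRM_natl; congr expR; ring.
  move: (expR _) (expR _) => a b.
  by have := sqr_ge0 (a - b); nra.
have mE1 : measurable_fun setT (fun z => (f1 z)%:E) by exact/measurable_EFinP.
have mE2 : measurable_fun setT (fun z => (f2 z)%:E) by exact/measurable_EFinP.
have E1 z : (0 <= (f1 z)%:E)%E by rewrite lee_fin expR_ge0.
have E2 z : (0 <= (f2 z)%:E)%E by rewrite lee_fin expR_ge0.
rewrite ge0_integralZl//; [|exact: emeasurable_funD|by move=> z _; exact: adde_ge0].
rewrite ge0_integralD//.
have I1 : (\int[N]_z (f1 z)%:E <= (2 * expR (32 * n%:R * theta ^+ 2))%:E)%E.
  rewrite (@integral_finitely_valued _ _ R N k iota _ iotaK miota iotap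
    (fun j => expR (4 * theta * `|x j|))); last by move=> j; exact: expR_ge0.
  rewrite lee_fin; apply: le_trans (@hyp_mgf_norm_le (4 * theta) _) _.
    by apply/andP; split; lra.
  by rewrite ler_pM2l// ler_expR; lra.
have I2 : (\int[N]_z (f2 z)%:E <= (2 * expR (32 * n%:R * theta ^+ 2))%:E)%E.
  apply: normal_exp_sqr_le.
    by apply: measurable_funM => //; exact: measurableT_comp.
  move=> z.
  have h := @mulr_le_sqrD R (2 * theta * sigma) `|z|.
  rewrite real_normK ?num_real// in h.
  apply: le_trans h _.
  have z2 : 0 <= z ^+ 2 by exact: sqr_ge0.
  have : (2 * theta * sigma) ^+ 2 <= 32 * n%:R * theta ^+ 2.
    have -> : (2 * theta * sigma) ^+ 2 = theta ^+ 2 * (4 * sigma ^+ 2) by ring.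
    rewrite [leRHS]mulrC; apply: ler_wpM2l; first exact: sqr_ge0.
    have := @bridge_sigma_sqr_le R n k n0 kn.
    have : 0 <= n%:R :> R by [].
    lra.
  lra.
apply: (@le_trans _ _ ((2^-1)%:E * ((2 * expR (32 * n%:R * theta ^+ 2))%:E +
    (2 * expR (32 * n%:R * theta ^+ 2))%:E))%E).
  by apply: lee_wpmul2l; [rewrite lee_fin invr_ge0|exact: leeD].
by rewrite -EFinD -EFinM lee_fin; lra.
Qed.

End large_drift.

Theorem lemma3 (R : realType) :
  exists theta1 M1 : R, 0 < theta1 /\
    forall (d : measure_display) (T : measurableType d) (P : probability T R)
      (X : nat -> {RV P >-> R}), iid_fair_signs X ->
    forall (n k : nat) (s : int), (2 <= n)%N ->
      3^-1 * n%:R <= k%:R :> R -> k%:R <= 2 / 3 * n%:R :> R ->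
      probable_value X n s ->
    exists (d' : measure_display) (T' : measurableType d')
      (Q : probability T' R) (Sk Z : {RV Q >-> R}),
      has_distribution Sk (bridge_distribution X n k s) /\
      has_distribution Z (normal_prob 0 1) /\
      let W := fun w : T' => Sk w - s%:~R * k%:R / n%:R in
      forall theta : R, theta <= theta1 ->
        ('E_Q[fun w => (expR (theta * `|W w - bridge_sigma n k * Z w|))%R] <=
         (expR (1 + M1 * theta ^+ 2 * (s%:~R ^+ 2 / n%:R)))%:E)%E.
Proof.
(* [300] exceeds [32 * 9], the coefficient arising for large drift. *)
exists (100 * 200 * 100)^-1, 300; split; first by rewrite invr_gt0; lra.
move=> d T P X hX n k s n2 k_ge k_le ps.
have n0 : (0 < n)%N by exact: leq_trans n2.
have N0 : 0 < n%:R :> R by rewrite ltr0n.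
have kn : (k <= n)%N by rewrite -(ler_nat R); lra.
have [m mn sE] := probable_valueP hX ps.
rewrite sE in ps *.
have S0 := hyp_total_gt0 hX kn ps.
set S := \sum_(0 <= j < k.+1) _ in S0.
pose w j : R := (hyp_weight n k m j)%:R.
pose p j := w j / S.
have p0 j : 0 <= p j by rewrite divr_ge0 ?ler0n ?ltW.
have p1 : \sum_(0 <= j < k.+1) p j = 1 by rewrite -mulr_suml divff ?gt_eqF.
(* A single coupling, chosen before [theta], serves all cases below. *)
have [iota [iotaK miota iotap iotaq]] := gaussian_coupling (hyp_window n k m) p0 p1.
have mSk : measurable_fun setT (fun z : measurableTypeR R => 2 * (iota z)%:R - k%:R : R).
  exact: (@measurable_fun_finitely_valued _ _ R k iota iotaK miota
    (fun j => 2 * j%:R - k%:R)).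
exists _, (measurableTypeR R), (normal_prob 0 1), (mk_RV _ mSk),
  (mk_RV _ (@measurable_id _ (measurableTypeR R) setT)).
split; [|split].
- move=> A mA; rewrite (bridge_distributionE hX)//.
  rewrite /distribution /pushforward mk_RVE.
  have -> : (\sum_(0 <= j < k.+1) (hyp_weight n k m j)%:R *
      \1_A (2 * j%:R - k%:R)) / S =
    \sum_(0 <= j < k.+1) \1_A (2 * j%:R - k%:R) * p j.
    by rewrite mulr_suml; apply: eq_bigr => j _; rewrite /p [RHS]mulrA; congr (_ / _); exact: mulrC.
  rewrite -(integral_finitely_valued iotaK miota iotap (g := fun j => \1_A (2 * j%:R - k%:R)))//.
  set f := (fun z : measurableTypeR R => 2 * (iota z)%:R - k%:R).
  have mfA : measurable (f @^-1` A) by rewrite -[X in measurable X]setTI; exact: mSk.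
  transitivity (\int[normal_prob 0 1]_z (\1_(f @^-1` A) z)%:E)%E.
    by rewrite integral_indic// setIT.
  by apply: eq_integral => z _; rewrite !indicE.
- by move=> A mA; rewrite /distribution /pushforward mk_RVE preimage_id.
move=> W theta th; rewrite unlock /W !mk_RVE /=.
have -> : (2 * m%:Z - n%:Z)%:~R = 2 * m%:R - n%:R :> R.
  by rewrite rmorphB rmorphM/= -!pmulrn.
under eq_integral do rewrite bridge_center//.
set r : R := (2 * m%:R - n%:R) ^+ 2 / n%:R.
have r0 : 0 <= r by rewrite divr_ge0 ?sqr_ge0// ltW.
have tr : 0 <= theta ^+ 2 * r by rewrite mulr_ge0 ?sqr_ge0.
have mD : measurable_fun setT (fun z : measurableTypeR R =>
    theta * `|2 * hyp_center n k m (iota z) - bridge_sigma n k * z|).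
  apply: measurable_funM => //; apply/measurableT_comp => //.
  apply: measurable_funB; last exact: measurable_funM.
  exact: (@measurable_fun_finitely_valued _ _ R k iota iotaK miota
    (fun j => 2 * hyp_center n k m j)).
have small (f : measurableTypeR R -> R) : measurable_fun setT f ->
    (forall z, f z <= 8^-1 + theta ^+ 2 * r + 3 / 8 * z ^+ 2) ->
    (\int[normal_prob 0 1]_z (expR (f z))%:E <= (expR (1 + 300 * theta ^+ 2 * r))%:E)%E.
  move=> mf hf; apply: le_trans (normal_exp_sqr_le mf hf) _; rewrite lee_fin.
  apply: (@le_trans _ _ (expR (7 / 8) * expR (8^-1 + theta ^+ 2 * r))).
    by apply: ler_wpM2r; [exact: expR_ge0|exact: two_le_expR].
  by rewrite -expRD ler_expR -mulrA; lra.
(* For [theta <= 0] the exponent is nonpositive. *)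
have [tneg|tpos] := leP theta 0.
  apply: small => // z; apply: (@le_trans _ _ 0); first by rewrite mulr_le0_ge0.
  by have := sqr_ge0 (z : R); lra.
have t01 : 0 <= theta <= (100 * 200 * 100)^-1 by rewrite ltW.
have [nlt|nge] := ltP n%:R (100 * 200 : R).
  apply: small => // z.
  by have := bridge_exponent_small n0 kn mn z t01 (iotaK z) nlt; lra.
have [mrange|mrange] := boolP ((n%:R / 3 <= m%:R :> R) && (m%:R <= 2 / 3 * n%:R :> R)).
  case/andP: mrange => m_ge m_le.
  have k_ge' : n%:R / 3 <= k%:R :> R by lra.
  apply: small => // z.
  apply: (bridge_exponent_main n0 kn mn t01).
  exact: (quantile_coupling_bound nge k_ge' k_le m_ge m_le S0 (iotaK z) (iotaq z)).
have t8 : 0 <= theta <= 8^-1 by apply/andP; case/andP: t01 => ? ?; split; lra.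
apply: le_trans (large_drift_bound n0 kn mn S0 iotaK miota iotap t8) _.
rewrite lee_fin.
apply: (@le_trans _ _ (expR 1 * expR (32 * n%:R * theta ^+ 2))).
  by apply: ler_wpM2r; [exact: expR_ge0|apply: two_le_expR; lra].
rewrite -expRD ler_expR lerD2l.
(* Here [|2 m - n| > n / 3], that is, [(2 m - n) ^ 2 > n ^ 2 / 9]. *)
have nr : n%:R <= 9 * r.
  rewrite /r mulrA ler_pdivlMr// -expr2.
  move: mrange; rewrite negb_and -!ltNge => /orP[h|h].
    have : 0 <= (n%:R - 3 * m%:R) * (2 * n%:R - 3 * m%:R) :> R.
      by apply: mulr_ge0; lra.
    nra.
  have : 0 <= (3 * m%:R - 2 * n%:R) * (3 * m%:R - n%:R) :> R.
    by apply: mulr_ge0; lra.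
  nra.
have : n%:R * theta ^+ 2 <= 9 * r * theta ^+ 2.
  by apply: ler_wpM2r => //; exact: sqr_ge0.
lra.
Qed.
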